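(* For every $1<p<\infty$ there exists a constant $C_{p}<\infty$, depending only on $p$, such that the following holds. For every real $r>2$, every filtered probability space $(\Omega,(\mathcal{F}_{n})_{n=0}^{\infty},\mu)$ with $\mathcal{F}_{\infty}:=\bigvee_{n=0}^{\infty}\mathcal{F}_{n}$, every weight $w$ on $\Omega$ (that is, every $\mathcal{F}_{\infty}$-measurable function $w:\Omega\to(0,\infty)$), and every integrable $\mathcal{F}_{\infty}$-measurable function $X:\Omega\to\mathbb{R}$, with associated martingale $X_{n}:=\mathbb{E}(X\mid\mathcal{F}_{n})$, $n=0,1,2,\dots$, we have \[ \lVert V^{r}X\rVert_{L^{p}(\Omega,w)}\leq C_{p}\sqrt{\frac{r}{r-2}}\;Q_{p}(w)^{\max(1,1/(p-1))}\,\lVert X\rVert_{L^{p}(\Omega,w)}, \] where $V^{r}X$ denotes the pathwise $r$-variation of the martingale $(X_{n})_{n}$ and $Q_{p}(w)$ is the martingale $A_{p}$ characteristic of $w$.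
   Context: Weighted norm: $\lVert X\rVert_{L^{p}(\Omega,w)}:=\bigl(\int_{\Omega}|X|^{p}\,w\,d\mu\bigr)^{1/p}$. Martingale $A_{p}$ characteristic, for $1<p<\infty$: \[ Q_{p}(w):=\sup_{\tau}\Bigl\lVert \mathbb{E}(w\mid\mathcal{F}_{\tau})\,\mathbb{E}\bigl(w^{-1/(p-1)}\mid\mathcal{F}_{\tau}\bigr)^{p-1}\Bigr\rVert_{L^{\infty}(w)}, \] where the supremum is over all stopping times $\tau$ adapted to $(\mathcal{F}_{n})_{n}$, and the $L^{\infty}(w)$ norm is the essential supremum with respect to the measure $w\,d\mu$ (equivalently $\mu$, since $w>0$). Conditional expectations of nonnegative functions are understood with values in $[0,\infty]$, so $Q_{p}(w)$ may equal $\infty$. The inequality is an inequality in $[0,\infty]$, with $0\cdot\infty=0$. Pathwise $r$-variation, for $0<r<\infty$ and $\omega\in\Omega$: \[ V^{r}X(\omega):=\sup_{u_{1}<u_{2}<\dotsb}\Bigl(\sum_{j}|X_{u_{j-1}}(\omega)-X_{u_{j}}(\omega)|^{r}\Bigr)^{1/r}, \] where the supremum is over arbitrary (strictly) increasing sequences of indices in $\{0,1,2,\dots\}$ and the sum runs over consecutive pairs of the sequence. *)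

(* Defs.v *)
From HB Require Import structures.
From mathcomp Require Import all_boot all_order all_algebra.
From mathcomp Require Import all_classical all_reals all_analysis.
From mathcomp Require Import measurable_realfun.

Set Implicit Arguments.
Unset Strict Implicit.
Unset Printing Implicit Defensive.

Import Order.TTheory GRing.Theory Num.Theory.
Import numFieldNormedType.Exports.

Local Open Scope classical_set_scope.
Local Open Scope ring_scope.
Local Open Scope ereal_scope.

(* The library's measurability, on [T] equipped with <<s G >>, which is [G]
   itself when [G] is a sigma-algebra. *)
Definition measurable_wrt d' (T : pointedType) (U : measurableType d')
    (G : set (set T)) (f : T -> U) : Prop :=
  measurable_fun [set: g_sigma_algebraType G] (f : g_sigma_algebraType G -> U).

Section filtrations.
Context d (T : measurableType d).

Definition filtration (F : nat -> set (set T)) : Prop :=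
  [/\ forall n, sigma_algebra [set: T] (F n),
      forall n, F n `<=` measurable &
      forall m n, (m <= n)%N -> F m `<=` F n].

Definition filtration_infty (F : nat -> set (set T)) : set (set T) :=
  <<s \bigcup_n F n >>.

(* Random times take values in {0, 1, 2, ...} together with infinity, which is
   encoded by [None]. *)
Definition time_le (tau : T -> option nat) (n : nat) : set T :=
  [set x | exists2 k, tau x = Some k & (k <= n)%N].

Definition stopping_time (F : nat -> set (set T)) (tau : T -> option nat) :
    Prop :=
  forall n, F n (time_le tau n).

Definition stopped_sigma_algebra (F : nat -> set (set T))
    (tau : T -> option nat) : set (set T) :=
  [set A | filtration_infty F A /\ forall n, F n (A `&` time_le tau n)].

End filtrations.

Section conditional_expectation.
Context d (T : measurableType d) (R : realType).
Variables (mu : probability T R) (G : set (set T)).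

(* [g] is a version of E(f | G), for [f] integrable. *)
Definition is_condexp (f g : T -> R) : Prop :=
  [/\ measurable_wrt G g,
      mu.-integrable [set: T] (EFin \o g) &
      forall A, G A -> \int[mu]_(x in A) (g x)%:E = \int[mu]_(x in A) (f x)%:E].

(* [g] is a version, with values in [0, +oo], of E(f | G), for [f] nonnegative
   but not necessarily integrable. *)
Definition is_condexp_ge0 (f : T -> R) (g : T -> \bar R) : Prop :=
  [/\ measurable_wrt G g,
      forall x, 0 <= g x &
      forall A, G A -> \int[mu]_(x in A) g x = \int[mu]_(x in A) (f x)%:E].

End conditional_expectation.

Section weights.
Context d (T : measurableType d) (R : realType).
Variable mu : probability T R.

Definition is_weight (F : nat -> set (set T)) (w : T -> R) : Prop :=
  measurable_wrt (filtration_infty F) w /\ forall x, (0 < w x)%R.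

Definition weighted_measure (w : T -> R) (A : set T) : \bar R :=
  \int[mu]_(x in A) (w x)%:E.

Definition weighted_Lnorm (p : R) (w : T -> R) (Y : T -> \bar R) : \bar R :=
  (\int[mu]_x (`|Y x| `^ p * (w x)%:E)) `^ p^-1.

(* [ess_sup] of the library, unfolded so as to apply to the set function
   [weighted_measure w] without a bundled measure structure. *)
Definition weighted_Linfty_norm (w : T -> R) (Y : T -> \bar R) : \bar R :=
  ereal_inf [set y | {ae weighted_measure w, forall x, `|Y x| <= y}].

(* Versions of conditional expectations are unique up to null sets, so that the
   norm below depends only on [tau]. *)
Definition Ap_characteristic (F : nat -> set (set T)) (p : R) (w : T -> R) :
    \bar R :=
  ereal_sup [set q | exists (tau : T -> option nat) (u v : T -> \bar R),
    [/\ stopping_time F tau,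
        is_condexp_ge0 mu (stopped_sigma_algebra F tau) w u,
        is_condexp_ge0 mu (stopped_sigma_algebra F tau)
          (fun x => w x `^ (- (p - 1)^-1))%R v &
        q = weighted_Linfty_norm w (fun x => u x * v x `^ (p - 1))]].

End weights.

(* The supremum is over infinite sequences; since a finite sequence extends to an
   infinite one and the terms are nonnegative, finite sequences are covered. *)
Definition variation_seq (T : Type) (R : realType) (r : R) (X : nat -> T -> R)
    (x : T) : \bar R :=
  ereal_sup [set s | exists2 u : nat -> nat,
    {homo u : i j / (i < j)%N} &
    s = (\sum_(0 <= j <oo) (`|X (u j) x - X (u j.+1) x| `^ r)%:E) `^ r^-1].

(* Main.v *)
Require Import Defs.
From HB Require Import structures.
From mathcomp Require Import all_boot all_order all_algebra.
From mathcomp Require Import all_classical all_reals all_analysis.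
From mathcomp Require Import measurable_realfun.
From mathcomp Require Import ring lra.

Set Implicit Arguments.
Unset Strict Implicit.
Unset Printing Implicit Defensive.

Import Order.TTheory GRing.Theory Num.Theory.
Import numFieldNormedType.Exports.

Local Open Scope classical_set_scope.
Local Open Scope ring_scope.

(* Splitting X into positive and negative parts reduces the theorem to nonnegative
   martingales x_n with terminal value X (the parts are nonnegative martingales,
   whose sum of r-variations dominates that of X).

   A nonnegative path is cut into stages.  A stage that starts at the value h ends
   when the path exceeds 4 h, or when the weighted numbers of its oscillations at
   the dyadic scales 2^-m h, with weights (2 / r)^m 4^-m, exceed
   sum_m (2 / r)^m <= r / (r - 2).  An oscillation of size about 2^-m h
   contributes (2^-m h)^r to the r-variation, and 2^-r <= (2 / r) / 4, so that the
   r-th power of the variation is at most C^r r / (r - 2) sum h^r over the stages;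
   hence V^r x is at most C sqrt (r / (r - 2)) times the sum of the values at the
   starts of the stages.  A quadratic Lyapunov function shows that a stage ends
   with conditional probability at most 1/2: the starts of the stages form a sparse
   family.

   With sigma := w^(-1/(p-1)), by duality the sparse sum is bounded by
   sum_n int_{E_n} (x_n / sigma_n) (g_n / w_n) sigma_n w_n, where the sets E_n are
   disjoint and sigma <= 8 sigma_n, w <= 8 w_n on E_n.  There the A_p condition gives
   sigma_n w_n <= C Q^max(1, 1/(p-1)) sigma^(1/p) w^(1/p'), and Doob's maximal
   inequalities for the measures sigma mu and w mu conclude.  Only the deterministic
   stopping times are used. *)

(** The obstacle is to obtain the square root of r / (r - 2) together with the sharp power of Q. The
    square root arises because the pathwise loss r / (r - 2), a number at least 1, affects the r-th
    power of the variation, and for r > 2 an r-th root of it is at most its square root. The weights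
    4^-m reflect orthogonality of increments: a martingale confined to [0, 4 h] oscillates by 2^-m h
    about 4^m times on average, so the weighted counts have expectations of order (2 / r)^m. The
    ratio 2 / r, in place of the exact 2^(2 - r), makes the full geometric sum equal to r / (r - 2).

    Only finitely many scales are used, more than there are times under consideration; oscillations
    below all scales are then few and small enough to be summed crudely. The price is that the
    stages depend on the time horizon, so the passage to infinite time goes through a lower
    limit. *)

Section powR_facts.
Context (R : realType).
Implicit Types a b r x y : R.

Lemma ge0_le_powR r x y : 0 <= r -> 0 <= x -> x <= y -> x `^ r <= y `^ r.
Proof.
by move=> r0 x0 xy; apply: ge0_ler_powR; rewrite // nnegrE// (le_trans x0).
Qed.

Lemma powRXn a r n : 0 <= a -> (a ^+ n) `^ r = (a `^ r) ^+ n.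
Proof.
move=> a0; elim: n => [|n IH]; first by rewrite !expr0 powR1.
by rewrite !exprS powRM ?exprn_ge0// IH.
Qed.

Lemma powR_superadd r a b : 1 <= r -> 0 <= a -> 0 <= b ->
  a `^ r + b `^ r <= (a + b) `^ r.
Proof.
move=> r1 a0 b0; have r0 : 0 < r by exact: lt_le_trans r1.
rewrite -(mulr_powRB1 a0 r0) -(mulr_powRB1 b0 r0) -(mulr_powRB1 _ r0) ?addr_ge0//.
by rewrite mulrDl lerD// ler_wpM2l// ge0_le_powR ?subr_ge0// ?lerDl ?lerDr.
Qed.

Lemma sum_powR_le r (I : Type) (s : seq I) (F : I -> R) : 1 <= r ->
  (forall i, 0 <= F i) -> \sum_(i <- s) F i `^ r <= (\sum_(i <- s) F i) `^ r.
Proof.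
move=> r1 F0; elim: s => [|i s IH]; first by rewrite !big_nil powR_ge0.
rewrite !big_cons (le_trans _ (powR_superadd r1 _ _))//; last exact: sumr_ge0.
exact: lerD.
Qed.

(** 2^-r is a quarter of 2^-(r - 2), and 2^(r - 2) >= exp((r - 2) / 2) >= 1 + (r - 2) / 2 = r / 2,
    where the first step is ln 2 >= 1/2. This lets the weight of a scale pay for an oscillation at
    that scale. *)
Lemma powR_half_le r : 2 < r -> (2^-1 : R) `^ r <= (2 / r) * 4^-1.
Proof.
move=> r2; have r0 : 0 < r by lra.
have ln2 : ln (2^-1 : R) <= - 2^-1.
  have := @le_ln1Dx R (- 2^-1) _.
  have -> : 1 + - 2^-1 = 2^-1 :> R by lra.
  by apply; lra.
rewrite -[in X in _ `^ X](subrK 2 r) powRD; last by rewrite (gt_eqF (_ : 0 < 2^-1)) ?implybT.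
rewrite [X in _ * X](_ : _ = 4^-1); last first.
  by rewrite powR_mulrn// expr2; field.
rewrite ler_pM2r ?invr_gt0//.
have h : 1 + (r - 2) / 2 <= expR ((r - 2) / 2) by exact: expR_ge1Dx.
rewrite /powR gt_eqF ?invr_gt0//.
apply: (@le_trans _ _ (expR (- ((r - 2) / 2)))).
  by rewrite ler_expR; nra.
rewrite expRN -[leRHS]invrK lef_pV2 ?posrE ?expR_gt0 ?invr_gt0 ?divr_gt0//.
by rewrite (le_trans _ h)// invf_div; lra.
Qed.

End powR_facts.

(** * The stages of a single nonnegative path and its r-variation *)

Section stages.
Context (R : realType) (r : R) (m0 : nat).

Let rho : R := 2 / r.

(* [height] is the value at the start of the stage; at scale [m] the path is
   compared with the last recorded value [ref m], which is renewed, and counted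
   in [cnt m], when the path is at distance more than [2 ^- m * (4 * height)]. *)
Record stage := Stage {
  height : R; ref : nat -> R; cnt : nat -> R; fresh : bool }.

Definition new_stage y := Stage y (fun=> y) (fun=> 0) true.

Definition touched S y m := 2^-1 ^+ m * (4 * height S) < `|y - ref S m|.

Definition moved S y := Stage (height S)
  (fun m => if touched S y m then y else ref S m)
  (fun m => if touched S y m then cnt S m + 1 else cnt S m) false.

(** The factor 4^-m normalises the count at scale [m] by its natural expected size; the remaining
    weight [rho ^+ m] is what [energy_cap] adds up. *)
Definition energy S := \sum_(m < m0) rho ^+ m * 4^-1 ^+ m * cnt S m.

Definition energy_cap := \sum_(m < m0) rho ^+ m.

(** The energy is tested after recording [y], so that a stage that continues never has energy above
    [energy_cap]. *)
Definition crit S y := (4 * height S < y) || (energy_cap < energy (moved S y)).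

Definition step S y := if crit S y then new_stage y else moved S y.

Fixpoint state (x : nat -> R) n :=
  if n is n'.+1 then step (state x n') (x n) else new_stage (x 0%N).

Definition stage_sum (x : nat -> R) n :=
  \sum_(k < n.+1) (if fresh (state x k) then x k else 0).

Hypothesis r2 : 2 < r.

Let r0 : 0 < r. Proof. exact: lt_trans r2. Qed.
Let rho_ge0 : 0 <= rho. Proof. by rewrite divr_ge0// ltW. Qed.
Let h0 : (0 : R) <= 2^-1. Proof. by []. Qed.

Lemma energy_cap_ge1 : (0 < m0)%N -> 1 <= energy_cap.
Proof.
rewrite /energy_cap; case: m0 => // m _; rewrite big_ord_recl expr0 lerDl.
by apply: sumr_ge0 => i _; rewrite exprn_ge0.
Qed.

Lemma energy_cap_le : energy_cap <= r / (r - 2).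
Proof.
have -> : r / (r - 2) = (1 - rho)^-1
  by rewrite /rho; field; rewrite lt0r_neq0//= subr_eq0 gt_eqF.
have d0 : 0 < 1 - rho by rewrite subr_gt0 /rho ltr_pdivrMr ?mul1r.
rewrite -[leRHS]mul1r ler_pdivlMr// mulrC /energy_cap mulr_sumr.
rewrite -(big_mkord xpredT (fun m => (1 - rho) * rho ^+ m)).
rewrite (eq_bigr (fun m => - rho ^+ m.+1 - - rho ^+ m)); last first.
  by move=> m _; rewrite mulrBl mul1r -exprS opprK addrC.
by rewrite telescope_sumr// expr0 opprK gerDr oppr_le0 exprn_ge0.
Qed.

Lemma energy_le S S' : (forall m, cnt S m <= cnt S' m) -> energy S <= energy S'.
Proof.
move=> SS'; apply: ler_sum => m _.
by rewrite ler_wpM2l// mulr_ge0 ?exprn_ge0 ?invr_ge0.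
Qed.

Context (x : nat -> R) (x0 : forall n, 0 <= x n).
Local Notation st n := (state x n).
Local Notation H n := (height (st n)).

(** While a stage continues, [crit] has failed, which bounds the path by [4 * height], and a
    reference farther away than its scale has just been renewed. The factor 4 in [touched] makes the
    coarsest scale as wide as the allowed range. *)
Lemma state_inv n : [/\ 0 <= H n, x n <= 4 * H n,
  forall m, 0 <= ref (st n) m <= 4 * H n,
  forall m, `|x n - ref (st n) m| <= 2^-1 ^+ m * (4 * H n) &
  forall m, 0 <= cnt (st n) m].
Proof.
elim: n => [|n [IH1 IH2 IH3 IH4 IH5]].
  split => //= [|m|m]; first by have := x0 0%N; lra.
    by have := x0 0%N; lra.
  by rewrite subrr normr0 mulr_ge0 ?exprn_ge0 ?mulr_ge0.
rewrite /= /step; case: ifPn => [_|/norP[]].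
  split => //= [|m|m]; first by have := x0 n.+1; lra.
    by have := x0 n.+1; lra.
  by rewrite subrr normr0 mulr_ge0 ?exprn_ge0 ?mulr_ge0.
rewrite -leNgt => xH _; split => //= m.
- by case: ifPn => // _; rewrite x0.
- case: ifPn => [_|]; last by rewrite /touched -leNgt.
  by rewrite subrr normr0 mulr_ge0 ?exprn_ge0 ?mulr_ge0.
- by case: ifPn => // _; rewrite addr_ge0.
Qed.

Lemma energy_ge0 n : 0 <= energy (st n).
Proof.
have [_ _ _ _ c0] := state_inv n.
by apply: sumr_ge0 => m _; rewrite !mulr_ge0 ?exprn_ge0 ?invr_ge0.
Qed.

Lemma energy_new y : energy (new_stage y) = 0.
Proof. by rewrite /energy big1// => m _; rewrite mulr0. Qed.

Lemma energy_le_cap n : energy (st n) <= energy_cap.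
Proof.
have cap0 : 0 <= energy_cap by apply: sumr_ge0 => m _; rewrite exprn_ge0.
case: n => [|n]; first by rewrite energy_new.
by rewrite /= /step; case: ifPn => [_|/norP[_]]; rewrite ?energy_new// -leNgt.
Qed.

(* [Psi n] bounds the [r]-variation up to time [n]; each stage is given
   [height ^ r] at its start and again at its end, to pay for the jumps of the
   variation that enter and leave it. *)
Let total n : R := \sum_(k < n.+1) (if fresh (st k) then x k `^ r else 0).
Let c : R := 16 `^ r.
Let Psi n : R := c * (energy_cap + 2) * (total n - H n `^ r) +
  c * (H n `^ r * (energy (st n) + 1)).

Let c0 : 0 <= c. Proof. exact: powR_ge0. Qed.

Let cap0 : 0 <= energy_cap.
Proof. by apply: sumr_ge0 => m _; rewrite exprn_ge0. Qed.

Lemma total_stage n : H n `^ r <= total n.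
Proof.
elim: n => [|n IH]; first by rewrite /total big_ord_recr big_ord0/= add0r.
rewrite /total big_ord_recr -/(total n)/= /step; case: ifPn => /= _.
  by rewrite lerDr (le_trans _ IH)// powR_ge0.
by rewrite addr0.
Qed.

(** [same] describes times in one stage; its last clause, taken scale by scale, later forces a count
    between two distant values. [far] describes times separated by the start of a stage: [Psi] has
    then gained both heights. *)
Let same u v := [/\ H v = H u, total v = total u,
  forall m, cnt (st u) m <= cnt (st v) m &
  forall m, cnt (st u) m + 1 <= cnt (st v) m \/ ref (st v) m = ref (st u) m].

Let far u v := Psi u + c * H u `^ r + c * H v `^ r <= Psi v.

Lemma Psi_same u v : same u v -> Psi u <= Psi v.
Proof.
move=> [e1 e2 e3 _]; rewrite /Psi e1 e2 lerD2l ler_wpM2l// ler_wpM2l ?powR_ge0//.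
by rewrite lerD2r energy_le.
Qed.

Lemma same_or_far u k : same u (u + k) \/ far u (u + k).
Proof.
elim: k => [|k IH]; first by rewrite addn0; left; split => // m; right.
rewrite addnS; set v := (u + k)%N in IH *.
have [crv|ncr] := boolP (crit (st v) (x v.+1)).
  right; rewrite /far.
  have eH : H v.+1 = x v.+1 by rewrite /= /step crv.
  have eT : total v.+1 = total v + x v.+1 `^ r.
    by rewrite /total [LHS]big_ord_recr /= /step crv.
  (* Closing the stage turns its coefficient [energy + 1] into [energy_cap + 2]. As the energy is at
     most the cap, the old height gains at least 1, and the new height enters with coefficient 1. *)
  have jump : Psi v + c * H v `^ r + c * H v.+1 `^ r <= Psi v.+1.
    rewrite {2}/Psi eH eT addrK.
    have -> : energy (st v.+1) = 0 by rewrite /= /step crv energy_new.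
    rewrite add0r mulr1 /Psi lerD2r.
    have := energy_le_cap v; have := powR_ge0 (H v) r; move: (H v `^ r) => a a0.
    move: (energy _) energy_cap => e cap ecap.
    have : c * (a * (e + 1)) <= c * (a * (cap + 1)).
      by rewrite ler_wpM2l// ler_wpM2l// lerD2r.
    by nra.
  have cu : 0 <= c * H v `^ r by rewrite mulr_ge0 ?powR_ge0.
  case: IH => [sm|]; last by rewrite /far; lra.
  by have := Psi_same sm; case: sm => <- _ _ _; lra.
have st1 : same v v.+1.
  have eT : total v.+1 = total v.
    by rewrite /total [LHS]big_ord_recr /= /step (negbTE ncr) addr0.
  rewrite /same eT /= /step (negbTE ncr) /=; split => // m; case: ifPn => _.
  - by rewrite lerDl.
  - by [].
  - by left.
  - by right.
case: IH => [[e1 e2 e3 e4]|fr]; [left|right].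
  case: st1 => s1 s2 s3 s4; split.
  - by rewrite s1.
  - by rewrite s2.
  - by move=> m; exact: le_trans (e3 m) (s3 m).
  - move=> m; case: (s4 m) => [le1|->]; last first.
      by case: (e4 m) => [le1|->]; [left; exact: le_trans le1 (s3 m)|right].
    by left; rewrite (le_trans _ le1)// lerD2r.
have := Psi_same st1; case: st1 => e _ _ _.
by move: fr; rewrite /far e; lra.
Qed.

(** The windows between 2 and 4 times the scales leave no gap, and their lower end is twice the
    scale: two points that far apart cannot both lie within one scale of a common reference. *)
Lemma dyadic_scale (a D : R) k : D <= 4 * a -> D <= 4 * (2^-1 ^+ k * a) \/
  exists2 m, (m < k)%N & 2 * (2^-1 ^+ m * a) < D <= 4 * (2^-1 ^+ m * a).
Proof.
move=> Da; elim: k => [|k [IH|[m mk mD]]]; first by left; rewrite expr0 mul1r.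
- have [D2|D2] := leP D (2 * (2^-1 ^+ k * a)); last first.
    by right; exists k; rewrite // D2.
  by left; rewrite exprS; lra.
- by right; exists m => //; exact: ltnW.
Qed.

(** An increment across the start of a stage is paid by the two heights in [far]. Inside a stage, an
    increment at a scale [m < m0] is paid by the count that it forces, and one below all scales by
    the error term. The base 16 of [c] is the range 4 h times the upper end 4 of the dyadic
    window. *)
Lemma increment_le u v : (u <= v)%N ->
  `|x u - x v| `^ r <= Psi v - Psi u + 2^-1 ^+ m0 * (c * total v).
Proof.
move=> uv; rewrite -(subnKC uv); move: (v - u)%N => k {uv v}.
set v := (u + k)%N.
have [Hu0 xu ru du cu] := state_inv u; have [Hv0 xv rv dv cv] := state_inv v.
have err0 : 0 <= 2^-1 ^+ m0 * (c * total v).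
  rewrite mulr_ge0 ?exprn_ge0// mulr_ge0// (le_trans _ (total_stage v))//.
  exact: powR_ge0.
have rs0 := ltW r0.
have D0 : 0 <= `|x u - x v| by [].
case: (same_or_far u k) => [sm|]; rewrite -/v; last first.
  rewrite /far => fr.
  have x0u := x0 u; have x0v := x0 v.
  suff : `|x u - x v| `^ r <= c * H u `^ r + c * H v `^ r by lra.
  have [Huv|Huv] := leP (H u) (H v).
    rewrite ler_wpDl ?mulr_ge0 ?powR_ge0// -powRM//.
    by apply: ge0_le_powR => //; rewrite ler_norml; lra.
  rewrite ler_wpDr ?mulr_ge0 ?powR_ge0// -powRM//.
  by apply: ge0_le_powR => //; rewrite ler_norml; lra.
have Psm := Psi_same sm; case: sm => e1 e2 e3 e4.
have Da : `|x u - x v| <= 4 * (4 * H u).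
  by rewrite ler_norml; have := x0 u; have := x0 v; lra.
have scale m : `|x u - x v| <= 4 * (2^-1 ^+ m * (4 * H u)) ->
    `|x u - x v| `^ r <= c * H u `^ r * (2^-1 `^ r) ^+ m.
  move=> Dm; rewrite -powRXn// /c -!powRM ?mulr_ge0 ?exprn_ge0//.
  by apply: ge0_le_powR => //; rewrite (le_trans Dm)//; lra.
have half r' : 2 < r' -> (2^-1 : R) `^ r' <= 2^-1.
  move=> r'2; rewrite (le_trans (powR_half_le r'2))//.
  have : 2 / r' <= 1 by rewrite ler_pdivrMr; lra.
  by lra.
case: (dyadic_scale m0 Da) => [/scale Dm|[m mm0 /andP[m1 /scale m2]]].
  rewrite ler_wpDl ?subr_ge0// (le_trans Dm)// mulrC.
  apply: ler_pM; rewrite ?exprn_ge0 ?powR_ge0 ?mulr_ge0 ?powR_ge0//.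
    by rewrite lerXn2r ?nnegrE ?powR_ge0// half.
  by rewrite ler_wpM2l// e2 total_stage.
rewrite ler_wpDr// (le_trans m2)//.
(* With an unchanged reference at scale [m], both values would lie within 2^-m (4 h) of it,
   contradicting [m1]. *)
have touch : cnt (st u) m + 1 <= cnt (st v) m.
  case: (e4 m) => // eref; have := du m; have := dv m; rewrite eref e1 => d1 d2.
  have : `|x u - x v| <= `|x u - ref (st u) m| + `|x v - ref (st u) m|.
    by rewrite [X in _ <= _ + X]distrC; exact: ler_distD.
  by lra.
have gain : energy (st u) + rho ^+ m * 4^-1 ^+ m <= energy (st v).
  rewrite /energy (bigD1 (Ordinal mm0))//= [leRHS](bigD1 (Ordinal mm0))//= addrAC.
  apply: lerD.
    rewrite -[X in _ + X]mulr1 -mulrDr ler_wpM2l//.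
    by rewrite mulr_ge0 ?exprn_ge0 ?invr_ge0.
  by apply: ler_sum => i _; rewrite ler_wpM2l// mulr_ge0 ?exprn_ge0 ?invr_ge0.
have weight : (2^-1 `^ r) ^+ m <= rho ^+ m * 4^-1 ^+ m.
  rewrite -exprMn lerXn2r ?nnegrE ?powR_ge0 ?mulr_ge0 ?invr_ge0//.
  exact: powR_half_le.
have ch0 : 0 <= c * H u `^ r by rewrite mulr_ge0 ?powR_ge0.
have {weight gain} : (2^-1 `^ r) ^+ m <= energy (st v) - energy (st u) by lra.
by move=> /(ler_wpM2l ch0); rewrite /Psi e1 e2; lra.
Qed.

Lemma total_le_stage_sum n : total n <= stage_sum x n `^ r.
Proof.
rewrite /total /stage_sum; have r1 : 1 <= r by rewrite ltW// (lt_trans _ r2)// ltr1n.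
rewrite (le_trans _ (@sum_powR_le _ r _ _ _ r1 _))//; last by move=> k; case: ifP.
by apply: ler_sum => k _; case: ifP => // _; rewrite powR0 ?gt_eqF.
Qed.

Lemma total_nd : {homo total : i j / (i <= j)%N >-> i <= j}.
Proof.
apply: homo_leq => [//|? ? ?|n]; first exact: le_trans.
by rewrite /total [leRHS]big_ord_recr /= lerDl; case: ifP; rewrite ?powR_ge0.
Qed.

(** [Psi] telescopes along the sequence. A strictly increasing sequence has J <= u J, so there are
    at most [N] error terms, and N < m0 < 2^m0 keeps their sum below [c * total N]. *)
Lemma variation_le_stage_sum N J (u : nat -> nat) :
  {homo u : i j / (i < j)%N} -> (u J <= N)%N -> (N < m0)%N ->
  \sum_(j < J) `|x (u j) - x (u j.+1)| `^ r <=
  (32 * Num.sqrt (r / (r - 2)) * stage_sum x N) `^ r.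
Proof.
move=> uincr uJN Nm0.
have Ju : (J <= u J)%N.
  by elim: J {uJN} => // J IH; rewrite (leq_ltn_trans IH)// uincr.
have und : {homo u : i j / (i <= j)%N} by exact: ltnW_homo.
have tN0 : 0 <= total N.
  by rewrite (le_trans _ (total_stage N))// powR_ge0.
have Psi_ge0 n : 0 <= Psi n.
  have d0 : 0 <= total n - H n `^ r by rewrite subr_ge0 total_stage.
  have e0 := energy_ge0 n; rewrite /Psi; apply: addr_ge0.
    by apply: mulr_ge0 => //; apply: mulr_ge0 => //; exact: addr_ge0.
  by rewrite mulr_ge0// mulr_ge0 ?powR_ge0// addr_ge0.
have Psi_le : Psi (u J) <= c * (energy_cap + 2) * total N.
  apply: (@le_trans _ _ (c * (energy_cap + 2) * total (u J))); last first.
    by rewrite ler_wpM2l ?total_nd// mulr_ge0// addr_ge0.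
  rewrite /Psi mulrBr -lerBrDl opprB addrCA subrr addr0 -mulrA ler_wpM2l//.
  rewrite mulrC ler_wpM2r ?powR_ge0//.
  by have := energy_le_cap (u J); lra.
apply: (@le_trans _ _ (c * (energy_cap + 3) * total N)).
  apply: (@le_trans _ _ (\sum_(j < J) (Psi (u j.+1) - Psi (u j) +
      2^-1 ^+ m0 * (c * total N)))).
    apply: ler_sum => j _; apply: le_trans (increment_le (ltnW (uincr _ _ (ltnSn j)))) _.
    rewrite lerD2l ler_wpM2l ?exprn_ge0// ler_wpM2l//.
    by apply: total_nd; apply: leq_trans uJN; exact: und.
  rewrite big_split/= sumr_const card_ord.
  rewrite -(big_mkord xpredT (fun j => Psi (u j.+1) - Psi (u j))) telescope_sumr//.
  have : (2^-1 ^+ m0 * (c * total N)) *+ J <= c * total N.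
    rewrite -mulrnAl ler_piMl ?mulr_ge0// -mulr_natr exprVn mulrC ler_pdivrMr ?exprn_gt0//.
    rewrite mul1r -natrX ler_nat (leq_trans (leq_trans Ju uJN))//.
    by rewrite (leq_trans (ltnW Nm0))// ltnW// ltn_expl.
  by have := Psi_ge0 (u 0%N); move: Psi_le; lra.
have G1 := energy_cap_ge1 (leq_ltn_trans (leq0n N) Nm0).
have GG := energy_cap_le; set G := r / (r - 2) in GG *.
have sG1 : 1 <= Num.sqrt G by rewrite -[leLHS]sqrtr1 ler_wsqrtr// (le_trans G1).
have ss0 : 0 <= stage_sum x N by apply: sumr_ge0 => k _; case: ifP.
rewrite !powRM ?mulr_ge0// ?sqrtr_ge0// (_ : 32 = 2 * 16); last by lra.
rewrite powRM// -/c mulrC [leRHS]mulrC.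
apply: ler_pM => //; first by rewrite mulr_ge0// addr_ge0.
  exact: total_le_stage_sum.
(* This is where the square root appears: t^2 <= t^r for t >= 1, applied to 2 and to the root of
   [G]. The 4 comes from energy_cap + 3 <= 4 G, as 1 <= energy_cap <= G. *)
have : 4 * G <= 2 `^ r * Num.sqrt G `^ r.
  have sq (t : R) : 1 <= t -> t ^+ 2 <= t `^ r.
    by move=> t1; rewrite -powR_mulrn ?(le_trans _ t1)// ler_powR// ltW.
  apply: ler_pM => //; first by rewrite (le_trans _ (le_trans G1 GG)).
    by rewrite (le_trans _ (sq _ _)) ?ler1n// expr2; lra.
  by rewrite (le_trans _ (sq _ _))// sqr_sqrtr// (le_trans _ (le_trans G1 GG)).
move=> h; apply: (@le_trans _ _ (c * (4 * G))).
  by rewrite ler_wpM2l//; lra.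
by rewrite (le_trans (ler_wpM2l c0 h))// mulrCA mulrA.
Qed.

End stages.

(** * Young-type inequalities and the pointwise use of the A_p condition *)

Section weight_inequalities.
Context (R : realType).
Implicit Types (p a b K : R).

Lemma powR_le_neg a b e : e <= 0 -> 0 < a -> a <= b -> b `^ e <= a `^ e.
Proof.
move=> e0 a0 ab; have b0 := lt_le_trans a0 ab.
rewrite -[e]opprK powRN [leRHS]powRN lef_pV2 ?posrE ?powR_gt0//.
by apply: ge0_le_powR; rewrite ?oppr_ge0// ltW.
Qed.

(** Young's inequality for a b^(p - 1), rearranged. Summed along a running maximum, it takes the
    place of the layer-cake formula in Doob's inequality. *)
Lemma powR_increment p a b : 1 < p -> 0 <= b -> b <= a ->
  a `^ p <= b `^ p + p / (p - 1) * (a * (a `^ (p - 1) - b `^ (p - 1))).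
Proof.
move=> p1 b0 ba; have a0 := le_trans b0 ba.
have p0 : 0 < p by lra.
have pm0 : 0 < p - 1 by lra.
have q0 : 0 < p / (p - 1) by rewrite divr_gt0.
have pq : p^-1 + (p / (p - 1))^-1 = 1 by field; rewrite !gt_eqF.
have := conjugate_powR a0 (powR_ge0 b (p - 1)) p0 q0 pq.
rewrite -powRrM mulrCA mulfV ?gt_eqF// mulr1 => young.
rewrite mulrBr mulr_powRB1// mulrBr.
have := ler_wpM2l (ltW q0) young.
rewrite mulrDr [X in _ <= _ + X]mulrCA mulfV ?gt_eqF// mulr1.
rewrite [X in _ <= X + _](_ : _ = (p / (p - 1) - 1) * a `^ p); last first.
  by field; rewrite !gt_eqF.
by lra.
Qed.

(** Young's inequality with a parameter, without optimal constants: for b = m^(p - 1), the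
    comparison of [m] with K a / e decides which term on the right dominates alone. A small [e] will
    allow the first term to be absorbed. *)
Lemma mul_absorb p K e a b : 1 < p -> 0 <= K -> 0 < e -> 0 <= a -> 0 <= b ->
  K * (a * b) <= e * b `^ (p / (p - 1)) + K `^ p * e `^ (1 - p) * a `^ p.
Proof.
move=> p1 K0 e0 a0 b0.
have p0 : 0 < p by lra.
have pm0 : 0 < p - 1 by lra.
set m := b `^ (p - 1)^-1; have m0 : 0 <= m by exact: powR_ge0.
have bE : b = m `^ (p - 1) by rewrite -powRrM mulVf ?gt_eqF// powRr1.
have -> : b `^ (p / (p - 1)) = m `^ p by rewrite -powRrM mulrC.
have [mle|mgt] := leP m (K / e * a).
  rewrite ler_wpDl ?mulr_ge0 ?powR_ge0 ?(ltW e0)//.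
  have -> : K `^ p * e `^ (1 - p) * a `^ p = K * (a * (K / e * a) `^ (p - 1)).
    rewrite powRM ?mulr_ge0 ?invr_ge0 ?(ltW e0)// powRM ?invr_ge0 ?(ltW e0)//.
    rewrite -(mulr_powRB1 K0 p0) -(mulr_powRB1 a0 p0).
    rewrite -[e^-1]powR_inv1 ?(ltW e0)// -powRrM mulN1r opprB; ring.
  rewrite ler_wpM2l// ler_wpM2l// [leLHS]bE; apply: ge0_le_powR => //; exact: ltW.
rewrite ler_wpDr ?mulr_ge0 ?powR_ge0// -(mulr_powRB1 m0 p0) mulrA -bE.
rewrite [leRHS]mulrA ler_wpM2r//.
by move: mgt; rewrite mulrAC ltr_pdivrMr// [m * e]mulrC => /ltW.
Qed.

(** The source of the exponent of Q. If p >= 2, s W = (W s^(p-1)) s^(2-p); otherwise s W = (W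
    s^(p-1))^(1/(p-1)) W^((p-2)/(p-1)). The last exponents are nonpositive, so the lower bounds for
    [s] and [W] become upper bounds, and the resulting power of sigma or of [w] is sigma^(1/p)
    w^(1-1/p). *)
Lemma weight_product p w W s Q : 1 < p -> 0 < w -> 0 < W -> 0 < s -> 0 < Q ->
  W * s `^ (p - 1) <= Q -> w <= 8 * W -> w `^ (- (p - 1)^-1) <= 8 * s ->
  s * W <= 8 `^ (p + (p - 1)^-1) * Q `^ Num.max 1 (p - 1)^-1 *
    ((w `^ (- (p - 1)^-1)) `^ p^-1 * w `^ (1 - p^-1)).
Proof.
move=> p1 w0 W0 s0 Q0 WsQ wW ss.
have p0 : 0 < p by lra.
have pm0 : 0 < p - 1 by lra.
have ip0 : 0 < (p - 1)^-1 by rewrite invr_gt0.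
set sg := w `^ _ in ss *; have sg0 : 0 < sg by exact: powR_gt0.
have eight e : e <= p + (p - 1)^-1 -> (8 : R) `^ e <= 8 `^ (p + (p - 1)^-1).
  by move=> ee; apply: ler_powR => //; rewrite ler1n.
have [p2|p2] := leP 2 p.
  have -> : Num.max 1 (p - 1)^-1 = 1.
    by apply/max_idPl; rewrite invf_le1//; lra.
  rewrite powRr1 ?(ltW Q0)//.
  have -> : sg `^ p^-1 * w `^ (1 - p^-1) = sg `^ (2 - p).
    have -> : w = sg `^ (1 - p).
      rewrite -powRrM (_ : - (p - 1)^-1 * (1 - p) = 1) ?powRr1 ?(ltW w0)//.
      by field; rewrite gt_eqF.
    rewrite -powRrM -powRD ?(gt_eqF sg0) ?implybT//; congr (_ `^ _).
    by field; rewrite gt_eqF.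
  have -> : s * W = W * s `^ (p - 1) * s `^ (2 - p).
    rewrite -mulrA -powRD ?(gt_eqF s0) ?implybT//.
    by rewrite (_ : p - 1 + (2 - p) = 1) ?powRr1 ?(ltW s0) 1?mulrC//; ring.
  rewrite [leRHS]mulrAC [leRHS]mulrC.
  apply: ler_pM => //; rewrite ?mulr_ge0 ?powR_ge0// ?(ltW W0)//.
  apply: (@le_trans _ _ ((8^-1 * sg) `^ (2 - p))).
    by apply: powR_le_neg; rewrite ?mulr_gt0//; lra.
  rewrite powRM ?(ltW sg0)// ler_wpM2r ?powR_ge0//.
  rewrite -powR_inv1// -powRrM mulN1r opprB eight//; lra.
have -> : Num.max 1 (p - 1)^-1 = (p - 1)^-1.
  by apply/max_idPr; rewrite invf_ge1//; lra.
set e := (p - 2) / (p - 1).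
have e0 : e <= 0 by rewrite /e ler_pdivrMr// mul0r; lra.
have -> : sg `^ p^-1 * w `^ (1 - p^-1) = w `^ e.
  rewrite -powRrM -powRD ?(gt_eqF w0) ?implybT//; congr (_ `^ _).
  by rewrite /e; field; rewrite !gt_eqF.
have -> : s * W = (W * s `^ (p - 1)) `^ (p - 1)^-1 * W `^ e.
  rewrite powRM ?powR_ge0 ?(ltW W0)// -powRrM mulfV ?gt_eqF// powRr1 ?(ltW s0)//.
  rewrite mulrAC -powRD ?(gt_eqF W0) ?implybT//.
  rewrite (_ : (p - 1)^-1 + e = 1) ?powRr1 ?(ltW W0) 1?mulrC//.
  by rewrite /e; field; rewrite gt_eqF.
rewrite [leRHS]mulrAC [leRHS]mulrC.
apply: ler_pM; rewrite ?powR_ge0//.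
  by apply: ge0_le_powR => //; rewrite ?mulr_ge0 ?powR_ge0// ltW.
apply: (@le_trans _ _ ((8^-1 * w) `^ e)).
  by apply: powR_le_neg; rewrite ?mulr_gt0//; lra.
rewrite powRM ?(ltW w0)// ler_wpM2r ?powR_ge0//.
rewrite -(@powR_inv1 _ 8)// -powRrM mulN1r eight//.
have -> : - e = (p - 1)^-1 - 1 by rewrite /e; field; rewrite gt_eqF.
by lra.
Qed.

End weight_inequalities.

(** * Measurability of the stages *)

Section measurable_stage.
Context (R : realType) (r : R) (m0 : nat).

(** Measurability is asked coordinate by coordinate, over an arbitrary [U], which will be the space
    with the sigma-algebra of the current time. *)
Definition measurable_stage d (U : measurableType d) (S : U -> stage R) :=
  [/\ measurable_fun [set: U] (fun t => height (S t)),
      forall m, measurable_fun [set: U] (fun t => ref (S t) m),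
      forall m, measurable_fun [set: U] (fun t => cnt (S t) m) &
      measurable_fun [set: U] (fun t => fresh (S t))].

Lemma measurable_energy d (U : measurableType d) (S : U -> stage R) :
  (forall m, measurable_fun [set: U] (fun t => cnt (S t) m)) ->
  measurable_fun [set: U] (fun t => energy r m0 (S t)).
Proof.
move=> mS; apply: measurable_sum => m; exact: measurable_funM.
Qed.

Lemma measurable_step d (U : measurableType d) (S : U -> stage R) (y : U -> R) :
  measurable_stage S -> measurable_fun [set: U] y ->
  measurable_stage (fun t => step r m0 (S t) (y t)).
Proof.
move=> [mH mc mN ms] my.
have mtouch m : measurable_fun [set: U] (fun t => touched (S t) (y t) m).
  apply: measurable_fun_ltr; first by do 2 apply: measurable_funM => //.
  by apply: measurableT_comp => //; exact: measurable_funB.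
have mcnt m : measurable_fun [set: U] (fun t => cnt (moved (S t) (y t)) m).
  by apply: measurable_fun_ifT => //; exact: measurable_funD.
have mcrit : measurable_fun [set: U] (fun t => crit r m0 (S t) (y t)).
  apply: measurable_or; first by apply: measurable_fun_ltr => //; exact: measurable_funM.
  by apply: measurable_fun_ltr => //; exact: measurable_energy.
split.
- rewrite (_ : (fun t => _) =
      fun t => if crit r m0 (S t) (y t) then y t else height (S t)).
    exact: measurable_fun_ifT.
  by apply/funext => t; rewrite /step; case: ifP.
- move=> m; rewrite (_ : (fun t => _) =
      fun t => if crit r m0 (S t) (y t) then y t else ref (moved (S t) (y t)) m).
    by apply: measurable_fun_ifT => //; exact: measurable_fun_ifT.
  by apply/funext => t; rewrite /step; case: ifP.
- move=> m; rewrite (_ : (fun t => _) =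
      fun t => if crit r m0 (S t) (y t) then 0 else cnt (moved (S t) (y t)) m).
    exact: measurable_fun_ifT.
  by apply/funext => t; rewrite /step; case: ifP.
- rewrite (_ : (fun t => _) = fun t => crit r m0 (S t) (y t))//.
  by apply/funext => t; rewrite /step; case: ifP.
Qed.

End measurable_stage.

(** * The quadratic Lyapunov function of a stage *)

Section lyapunov.
Context (R : realType) (r : R) (m0 : nat).
Hypothesis r2 : 2 < r.
Implicit Types (S : stage R) (y : R).

Let rho : R := 2 / r.
Let rho_ge0 m : 0 <= rho ^+ m.
Proof. by rewrite exprn_ge0// divr_ge0// ltW// (lt_trans _ r2). Qed.

(* The bracket is affine in [y], hence a martingale along [x] while the stage
   does not change; renewing [ref S m] replaces it by
   [bracket + 4 ^- m - (y - ref S m) ^ 2 / (4 * height S) ^ 2], which is smaller. *)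
Definition lyapunov S y := \sum_(m < m0) rho ^+ m *
  (4^-1 ^+ m * cnt S m + (4 * height S) ^- 2 *
    (ref S m ^+ 2 + 2 * (4 * height S - ref S m) * y)).

Definition lyapunov_cst S := \sum_(m < m0) rho ^+ m *
  (4^-1 ^+ m * cnt S m + (4 * height S) ^- 2 * ref S m ^+ 2).

Definition lyapunov_lin S := \sum_(m < m0) rho ^+ m *
  ((4 * height S) ^- 2 * (2 * (4 * height S - ref S m))).

Lemma lyapunovE S y : lyapunov S y = lyapunov_cst S + lyapunov_lin S * y.
Proof.
rewrite /lyapunov /lyapunov_cst /lyapunov_lin mulr_suml -big_split/=.
by apply: eq_bigr => m _; ring.
Qed.

(** At the start each scale contributes (1 + 2 * 3) / 16 = 7 / 16 of its weight, which is below one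
    half. *)
Lemma lyapunov_new y : 0 < y -> lyapunov (new_stage y) y <= energy_cap r m0 / 2.
Proof.
move=> y0; rewrite /energy_cap mulr_suml; apply: ler_sum => m _ /=.
rewrite ler_wpM2l// mulr0 add0r.
rewrite (_ : _ * _ = 7 / 16); first by lra.
by field; rewrite gt_eqF.
Qed.

Lemma lyapunov_moved S y : 0 < height S ->
  lyapunov (moved S y) y <= lyapunov S y.
Proof.
move=> h0; apply: ler_sum => m _ /=; rewrite ler_wpM2l//.
case: ifPn => // tch; rewrite /touched in tch.
set a := 4 * height S in tch *.
have a0 : 0 < a by rewrite mulr_gt0.
have : (2^-1 ^+ m * a) ^+ 2 <= (y - ref S m) ^+ 2.
  rewrite -[leRHS]real_normK ?num_real// lerXn2r ?nnegrE//.
    by rewrite mulr_ge0 ?exprn_ge0// ltW.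
  exact: ltW.
rewrite exprMn -exprM mulnC exprM (_ : 2^-1 ^+ 2 = 4^-1); last by rewrite expr2; field.
rewrite -ler_pdivlMr ?exprn_gt0// => le4.
suff : 4^-1 ^+ m + a ^- 2 * (y ^+ 2 + 2 * (a - y) * y) <=
   a ^- 2 * (ref S m ^+ 2 + 2 * (a - ref S m) * y) by lra.
rewrite -lerBrDr (le_trans le4)// -mulrBr mulrC ler_wpM2l ?invr_ge0 ?sqr_ge0//.
by rewrite [leRHS](_ : _ = (y - ref S m) ^+ 2)//; ring.
Qed.

Lemma lyapunov_ge0 S y : 0 <= y -> (forall m, 0 <= cnt S m) ->
  (forall m, 0 <= ref S m <= 4 * height S) -> 0 <= lyapunov S y.
Proof.
move=> y0 c0 rS; apply: sumr_ge0 => m _; have /andP[r0 r1] := rS m.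
rewrite mulr_ge0// addr_ge0 ?mulr_ge0 ?exprn_ge0 ?invr_ge0 ?exprn_even_ge0//.
by rewrite addr_ge0 ?sqr_ge0// !mulr_ge0// subr_ge0.
Qed.

(** Let a = 4 h. If y > a, each scale alone reaches its weight, because ref^2 + 2 (a - ref) y >= a^2
    + (a - ref)^2. Otherwise the energy of the moved stage exceeds the cap; that energy is part of
    the Lyapunov function of the moved stage, which is at most that of [S]. *)
Lemma lyapunov_crit S y : 0 < height S -> 0 <= y -> (forall m, 0 <= cnt S m) ->
  (forall m, 0 <= ref S m <= 4 * height S) ->
  crit r m0 S y -> energy_cap r m0 <= lyapunov S y.
Proof.
move=> h0 y0 c0 rS; rewrite /crit; have [ay _|ya /= cr] := ltP (4 * height S) y.
  apply: ler_sum => m _; rewrite -[leLHS]mulr1 ler_wpM2l//.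
  have /andP[r0 r1] := rS m.
  rewrite ler_wpDl ?mulr_ge0 ?exprn_ge0 ?invr_ge0//.
  set a := 4 * height S in ay r1 *.
  have a0 : 0 < a by rewrite mulr_gt0.
  rewrite mulrC ler_pdivlMr ?exprn_gt0// mul1r; nra.
apply/ltW/(lt_le_trans cr)/(le_trans _ (lyapunov_moved y h0)).
apply: ler_sum => m _; rewrite -mulrA ler_wpM2l// ler_wpDr//.
rewrite mulr_ge0 ?invr_ge0 ?sqr_ge0//.
have /andP[r0 r1] := rS m.
by rewrite addr_ge0 ?sqr_ge0//= !mulr_ge0// subr_ge0; case: ifP.
Qed.

End lyapunov.

Local Open Scope ereal_scope.

(** * Integrals tested on a sub-sigma-algebra *)

Section sub_sigma_algebra.
Context d (T : measurableType d) (R : realType) (mu : {measure set T -> \bar R}).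
Context (G : set (set T)).
Hypotheses (sG : sigma_algebra [set: T] G) (Gm : G `<=` measurable).

Lemma measurable_subalgE (A : set T) :
  measurable (A : set (g_sigma_algebraType G)) = G A.
Proof. by rewrite -[in RHS](sigma_algebra_id sG). Qed.

Lemma measurable_wrt_preimage d' (U : measurableType d') (f : T -> U) (B : set U) :
  measurable_wrt G f -> measurable B -> G (f @^-1` B).
Proof.
move=> mf mB; rewrite -measurable_subalgE -[X in measurable X]setTI.
exact: mf.
Qed.

Lemma measurable_wrt_fun d' (U : measurableType d') (f : T -> U) :
  measurable_wrt G f -> measurable_fun [set: T] f.
Proof.
move=> mf _ B mB; rewrite setTI; apply: Gm; exact: measurable_wrt_preimage.
Qed.

Import HBNNSimple.

Lemma ge0_integral_indic_mul (A : set T) (f : T -> \bar R) :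
  \int[mu]_x ((\1_A x)%:E * f x) = \int[mu]_(x in A) f x.
Proof.
rewrite [RHS]integral_mkcond; apply: eq_integral => x _.
by rewrite patchE indicE; case: ifPn => _; rewrite ?mul1e ?mul0e.
Qed.

(* Order of the two measures [f mu] and [g mu] on [G] passes from indicators
   to simple functions, and to [phi] by monotone convergence. *)
Lemma ge0_le_integral_subalg (f g : T -> R) (phi : T -> R) :
  measurable_fun [set: T] f -> measurable_fun [set: T] g ->
  (forall x, (0 <= f x)%R) -> (forall x, (0 <= g x)%R) ->
  (forall A, G A -> \int[mu]_(x in A) (f x)%:E <= \int[mu]_(x in A) (g x)%:E) ->
  measurable_wrt G phi -> (forall x, (0 <= phi x)%R) ->
  \int[mu]_x ((phi x)%:E * (f x)%:E) <= \int[mu]_x ((phi x)%:E * (g x)%:E).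
Proof.
move=> mf mg f0 g0 fg mphi phi0.
have mEphi : measurable_fun [set: g_sigma_algebraType G] (EFin \o phi).
  exact/measurable_EFinP.
pose a n : {nnsfun (g_sigma_algebraType G) >-> R} := nnsfun_approx measurableT mEphi n.
have simple n (h : T -> R) : measurable_fun setT h -> (forall x, (0 <= h x)%R) ->
    \int[mu]_x ((a n x)%:E * (h x)%:E) =
    \sum_(y \in range (a n)) y%:E * \int[mu]_(x in a n @^-1` [set y]) (h x)%:E.
  move=> mh h0.
  have mA y : measurable (a n @^-1` [set y] : set T).
    apply: Gm; rewrite -measurable_subalgE -[X in measurable X]setTI.
    exact: (measurable_funP (a n)).
  transitivity (\int[mu]_x (\sum_(y \in range (a n))
      (y * \1_(a n @^-1` [set y]) x)%:E * (h x)%:E)).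
    apply: eq_integral => x _.
    rewrite -ge0_mule_fsuml => [|y]; last exact: nnfun_muleindic_ge0.
    by rewrite (fimfunE (a n) x) fsumEFin.
  have mterm y : measurable_fun [set: T]
      (fun x => (y * \1_(a n @^-1` [set y]) x)%:E * (h x)%:E).
    apply: emeasurable_funM; apply/measurable_EFinP => //.
    by apply: measurable_funM => //; exact: measurable_indic.
  rewrite ge0_integral_fsum//; last first.
    by move=> y x _; rewrite mule_ge0 ?nnfun_muleindic_ge0 ?lee_fin.
  apply: eq_fsbigr => y; rewrite inE => -[t _ <-].
  under eq_integral do rewrite EFinM -muleA.
  rewrite ge0_integralZl_EFin//.
  - by rewrite ge0_integral_indic_mul.
  - by move=> x _; rewrite mule_ge0 ?lee_fin.
  - by apply/measurable_EFinP; apply: measurable_funM.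
have cvga (h : T -> R) : measurable_fun setT h -> (forall x, (0 <= h x)%R) ->
    \int[mu]_x ((a n x)%:E * (h x)%:E) @[n --> \oo] --> \int[mu]_x ((phi x)%:E * (h x)%:E).
  move=> mh h0.
  have -> : \int[mu]_x ((phi x)%:E * (h x)%:E) =
      \int[mu]_x (limn (fun n => (a n x)%:E * (h x)%:E)).
    apply: eq_integral => x _; apply/esym/cvg_lim => //.
    by apply: cvgeZr => //; apply: cvg_nnsfun_approx => // y _; rewrite lee_fin.
  apply: cvg_monotone_convergence => //.
  - move=> n; apply: emeasurable_funM; apply/measurable_EFinP => //.
    by apply: measurable_wrt_fun; exact: (measurable_funP (a n)).
  - by move=> n x _; rewrite mule_ge0 ?lee_fin.
  - move=> x _ m n mn; rewrite lee_wpmul2r ?lee_fin//.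
    by move/lefP: (nd_nnsfun_approx measurableT mEphi mn); apply.
apply: lee_cvg_to (cvga f mf f0) (cvga g mg g0) _.
apply: nearW => n; rewrite !simple//; apply: lee_fsum => //.
move=> y [t _ <-]; rewrite lee_wpmul2l ?lee_fin//; apply: fg.
rewrite -measurable_subalgE -[X in measurable X]setTI.
exact: (measurable_funP (a n)).
Qed.

(** Reduction to the whole space by putting the indicator of [D] into all three functions. *)
Lemma ge0_le_integral_subalg_in (D : set T) (f g phi : T -> R) :
  measurable_fun [set: T] f -> measurable_fun [set: T] g ->
  (forall x, (0 <= f x)%R) -> (forall x, (0 <= g x)%R) ->
  (forall A, G A -> A `<=` D ->
    \int[mu]_(x in A) (f x)%:E <= \int[mu]_(x in A) (g x)%:E) ->
  G D -> measurable_wrt G phi -> (forall x, D x -> (0 <= phi x)%R) ->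
  \int[mu]_(x in D) (phi x * f x)%:E <= \int[mu]_(x in D) (phi x * g x)%:E.
Proof.
move=> mf mg f0 g0 fg GD mphi phi0.
have mD := Gm GD.
have mD' : measurable (D : set (g_sigma_algebraType G)) by rewrite measurable_subalgE.
have m1 : measurable_fun [set: T] (\1_D : T -> R) by exact: measurable_indic.
have E (h : T -> R) : \int[mu]_(x in D) (phi x * h x)%:E =
    \int[mu]_x ((\1_D x * phi x)%:E * (\1_D x * h x)%:E).
  rewrite integral_mkcond; apply: eq_integral => x _.
  by rewrite patchE indicE; case: ifPn => _; rewrite ?mul1r// !mul0r mul0e.
rewrite !E; apply: ge0_le_integral_subalg => //.
- exact: measurable_funM.
- exact: measurable_funM.
- by move=> x; rewrite mulr_ge0.
- by move=> x; rewrite mulr_ge0.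
- move=> A GA.
  have I (h : T -> R) : \int[mu]_(x in A) (\1_D x * h x)%:E =
      \int[mu]_(x in A `&` D) (h x)%:E.
    rewrite integral_mkcondr; apply: eq_integral => x _.
    by rewrite patchE indicE; case: ifPn => _; rewrite ?mul1r// !mul0r.
  rewrite !I; apply: fg; last exact: subIsetr.
  by rewrite -measurable_subalgE; apply: measurableI; rewrite measurable_subalgE.
- apply: measurable_funM => //; exact: measurable_indic.
- move=> x; rewrite indicE; have [/set_mem Dx|_] := boolP (x \in D).
    by rewrite mul1r phi0.
  by rewrite mul0r.
Qed.

Lemma ge0_eq_integral_subalg_in (D : set T) (f g phi : T -> R) :
  measurable_fun [set: T] f -> measurable_fun [set: T] g ->
  (forall x, (0 <= f x)%R) -> (forall x, (0 <= g x)%R) ->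
  (forall A, G A -> A `<=` D ->
    \int[mu]_(x in A) (f x)%:E = \int[mu]_(x in A) (g x)%:E) ->
  G D -> measurable_wrt G phi -> (forall x, D x -> (0 <= phi x)%R) ->
  \int[mu]_(x in D) (phi x * f x)%:E = \int[mu]_(x in D) (phi x * g x)%:E.
Proof.
move=> mf mg f0 g0 fg GD mphi phi0; apply/eqP; rewrite eq_le.
by apply/andP; split; apply: ge0_le_integral_subalg_in => // A GA AD; rewrite fg.
Qed.

End sub_sigma_algebra.

Lemma measurable_wrtS d' (T : pointedType) (U : measurableType d')
    (G G' : set (set T)) (f : T -> U) :
  G `<=` G' -> measurable_wrt G f -> measurable_wrt G' f.
Proof.
move=> GG' mf mT B mB; change (<<s G' >> (setT `&` f @^-1` B)).
by apply: (@sub_sigma_algebra2 _ setT G' G GG'); exact: (mf measurableT B mB).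
Qed.

(** * Existence of conditional expectations of nonnegative functions *)

Section conditional_expectation_existence.
Context d (T : measurableType d) (R : realType) (mu : probability T R).
Context (G : set (set T)).
Hypotheses (sG : sigma_algebra [set: T] G) (Gm : G `<=` measurable).

Let GT := g_sigma_algebraType G.

Lemma measurable_fun_id_subalg : measurable_fun [set: T] (id : T -> GT).
Proof.
by move=> _ B mB; rewrite setTI; apply: Gm; rewrite -measurable_subalgE.
Qed.

(** The restriction of [mu] to [G], as a measure on the space whose measurable sets are those of
    [G]: a Radon-Nikodym density there is automatically [G]-measurable. *)
Definition pushforward_subalg : set GT -> \bar R :=
  fun A => mu A.

Let muG0 : pushforward_subalg set0 = 0.
Proof. exact: measure0. Qed.

Let muG_ge0 A : 0 <= pushforward_subalg A.
Proof. by rewrite /pushforward_subalg measure_ge0. Qed.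

Let muG_semi_sigma_additive : semi_sigma_additive pushforward_subalg.
Proof.
move=> B mB tB mUB; apply: measure_semi_sigma_additive => //.
- by move=> i; apply: Gm; rewrite -measurable_subalgE.
- by apply: Gm; rewrite -measurable_subalgE.
Qed.

HB.instance Definition _ := isMeasure.Build _ _ _ pushforward_subalg
  muG0 muG_ge0 muG_semi_sigma_additive.

Let muG_fin : fin_num_fun pushforward_subalg.
Proof.
move=> A mA; apply: fin_num_measure.
by apply: Gm; rewrite -measurable_subalgE.
Qed.

HB.instance Definition _ := @Measure_isFinite.Build _ _ _ pushforward_subalg muG_fin.

Lemma integral_pushforward_subalg (A : set T) (f : T -> \bar R) :
  G A -> measurable_wrt G f -> (forall x, 0 <= f x) ->
  \int[pushforward_subalg]_(x in A) f x = \int[mu]_(x in A) f x.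
Proof.
move=> GA mf f0.
have := @ge0_integral_pushforward _ _ T GT R id measurable_fun_id_subalg mu A f.
apply => //; first by rewrite measurable_subalgE.
exact: measurable_funTS.
Qed.

Section integrable.
Context (f : T -> R).
Hypotheses (intf : mu.-integrable [set: T] (EFin \o f)) (f0 : forall x, (0 <= f x)%R).

Let nu (A : set GT) : \bar R := \int[mu]_(x in A) (f x)%:E.

Let mf : measurable_fun [set: T] (EFin \o f).
Proof. exact: measurable_int intf. Qed.

Let nu0 : nu set0 = 0. Proof. exact: integral_set0. Qed.

Let nu_ge0 A : 0 <= nu A.
Proof. by apply: integral_ge0 => x _; rewrite lee_fin. Qed.

Let nu_semi_sigma_additive : semi_sigma_additive nu.
Proof.
move=> B mB tB mUB.
have f0' : forall x, 0 <= (EFin \o f) x by move=> x; rewrite lee_fin.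
apply: (semi_sigma_additive_nng_induced mf f0') => //.
- by move=> i; apply: Gm; rewrite -measurable_subalgE.
- by apply: Gm; rewrite -measurable_subalgE.
Qed.

HB.instance Definition _ := isMeasure.Build _ _ _ nu
  nu0 nu_ge0 nu_semi_sigma_additive.

Let nu_fin : fin_num_fun nu.
Proof.
move=> A mA; apply: integrable_fin_num.
  by apply: Gm; rewrite -measurable_subalgE.
apply: integrableS intf => //.
by apply: Gm; rewrite -measurable_subalgE.
Qed.

HB.instance Definition _ := @Measure_isFinite.Build _ _ _ nu nu_fin.

Lemma condexp_integrable_ex : exists g : T -> R,
  [/\ measurable_wrt G g, forall x, (0 <= g x)%R &
   forall A, G A -> \int[mu]_(x in A) (g x)%:E = \int[mu]_(x in A) (f x)%:E].
Proof.
have dom : nu `<< pushforward_subalg.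
  apply/null_content_dominatesP => A mA muA.
  rewrite /nu; apply: null_set_integral => //.
    by apply: Gm; rewrite -measurable_subalgE.
  apply: measurable_funTS; exact: measurable_int intf.
have [g [g0 gfin /measurable_int mg gE]] := radon_nikodym_sigma_finite dom.
have mfg : measurable_wrt G (fine \o g).
  by apply: measurableT_comp mg => //; exact: fine_measurable.
exists (fine \o g); split => // [x|A GA]; first exact: fine_ge0.
have -> : \int[mu]_(x in A) (f x)%:E = nu A by [].
rewrite gE ?measurable_subalgE// (integral_pushforward_subalg GA mg)//.
by apply: eq_integral => x _; rewrite /= fineK.
Qed.

End integrable.

Lemma condexp_ge0_ex (w : T -> R) :
  measurable_fun [set: T] w -> (forall x, (0 <= w x)%R) ->
  exists u, is_condexp_ge0 mu G w u.
Proof.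
move=> mw w0.
(* Layers of [w] of height at most 1, integrable even if [w] is not; their conditional expectations
   are added up, possibly to +oo. *)
pose v k x := (Num.min (w x) k.+1%:R - Num.min (w x) k%:R)%R.
have v0 k x : (0 <= v k x)%R.
  by rewrite subr_ge0 le_min !ge_min lexx/= ler_nat leqnSn orbT.
have mv k : measurable_fun [set: T] (v k).
  by apply: measurable_funB; exact: measurable_minr.
have v1 k x : (v k x <= 1)%R.
  rewrite /v lerBlDr -natr1; have [h|h] := leP (w x) k%:R.
    by rewrite ge_min ler_wpDl.
  by rewrite addrC ge_min lexx orbT.
have iv k : mu.-integrable [set: T] (EFin \o v k).
  have i1 := finite_measure_integrable_cst mu 1%R (@measurableT _ T).
  apply: le_integrable i1 => //; first exact/measurable_EFinP.
  by move=> x _ /=; rewrite lee_fin normr1 ger0_norm.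
have /choice[g gP] k := condexp_integrable_ex (iv k) (v0 k).
have sumv x : \sum_(0 <= k <oo) (v k x)%:E = (w x)%:E.
  apply/cvg_lim => //.
  have -> : (fun n => \sum_(0 <= k < n) (v k x)%:E) =
      fun n => (Num.min (w x) n%:R)%:E.
    apply/funext => n; rewrite sumEFin telescope_sumr//.
    by rewrite (min_idPr (w0 x)) subr0.
  apply: cvg_near_cst; near=> n; congr EFin; apply/min_idPl.
  near: n; exact: nbhs_infty_ger.
exists (fun x => \sum_(0 <= k <oo) (g k x)%:E); split.
- apply: ge0_emeasurable_sum => [k x _ _|k _].
    by rewrite lee_fin; case: (gP k).
  by apply/measurable_EFinP; case: (gP k).
- by move=> x; apply: nneseries_ge0 => k _ _; rewrite lee_fin; case: (gP k).
- move=> A GA; have mA := Gm GA.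
  have mg k : measurable_fun [set: T] (g k).
    by case: (gP k) => mg _ _; exact: (measurable_wrt_fun sG Gm mg).
  rewrite integral_nneseries//; last 2 first.
  + by move=> k; apply: measurable_funTS; exact/measurable_EFinP.
  + by move=> k x _; rewrite lee_fin; case: (gP k).
  rewrite (eq_integral _ _ (fun x _ => esym (sumv x))).
  rewrite integral_nneseries//; last 2 first.
  + by move=> k; apply: measurable_funTS; exact/measurable_EFinP.
  + by move=> k x _; rewrite lee_fin.
  by apply: eq_eseriesr => k _; case: (gP k) => _ _; apply.
Unshelve. all: by end_near. Qed.

End conditional_expectation_existence.

(** * A stage ends with conditional probability at most one half *)

Section stage_decay.
Context d (T : measurableType d) (R : realType) (mu : probability T R).
Context (F : nat -> set (set T)) (hF : filtration F).
Context (r : R) (r2 : (2 < r)%R) (m0 : nat) (m0_gt0 : (0 < m0)%N).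
Context (x : nat -> T -> R) (x0 : forall n t, (0 <= x n t)%R).
Hypothesis mx : forall n, measurable_wrt (F n) (x n).
Hypothesis xE : forall n A, F n A ->
  \int[mu]_(t in A) (x n.+1 t)%:E = \int[mu]_(t in A) (x n t)%:E.

Local Notation st n t := (state r m0 (x^~ t) n).

Let sF n : sigma_algebra [set: T] (F n). Proof. by case: hF. Qed.
Let Fm n : F n `<=` measurable. Proof. by case: hF. Qed.
Let FS n : F n `<=` F n.+1. Proof. by case: hF => _ _; apply. Qed.
Let FS' m n : (m <= n)%N -> F m `<=` F n. Proof. by case: hF => _ _; apply. Qed.

Lemma measurable_state n :
  measurable_stage (fun t : g_sigma_algebraType (F n) => st n t).
Proof.
elim: n => [|n [mH mc mN mf]]; first by split => // m; exact: mx.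
apply: (@measurable_step _ r m0 _ (g_sigma_algebraType (F n.+1)) (fun t => st n t)).
  split.
  - exact: (measurable_wrtS (@FS n) mH).
  - by move=> m; exact: (measurable_wrtS (@FS n) (mc m)).
  - by move=> m; exact: (measurable_wrtS (@FS n) (mN m)).
  - exact: (measurable_wrtS (@FS n) mf).
exact: mx.
Qed.

Lemma measurable_wrt_fresh n : F n [set t | fresh (st n t)].
Proof.
case: (measurable_state n) => _ _ _ mf.
rewrite (_ : [set t | _] = (fun t => fresh (st n t)) @^-1` [set true]).
  exact: (measurable_wrt_preimage (sF n) mf).
by apply/seteqP; split => t /=.
Qed.

Lemma setI_wrt n A B : F n A -> F n B -> F n (A `&` B).
Proof.
move=> FA FB; rewrite -(measurable_subalgE (sF n)).
by apply: measurableI; rewrite measurable_subalgE.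
Qed.

Lemma setD_wrt n A B : F n A -> F n B -> F n (A `\` B).
Proof.
move=> FA FB; rewrite -(measurable_subalgE (sF n)).
by apply: measurableD; rewrite measurable_subalgE.
Qed.

Section from_time.
Context (n0 : nat) (A : set T) (FA : F n0 A).
Hypothesis A_fresh : A `<=` [set t | fresh (st n0 t) /\ (0 < x n0 t)%R].

(** The part of [A] on which the stage started at time [n0] is still running at time [n0 + k]. *)
Let D k := A `\` \bigcup_(j < k) [set t | fresh (st (n0 + j.+1) t)].

Let DS k : D k.+1 = D k `\` [set t | fresh (st (n0 + k.+1) t)].
Proof. by rewrite /D !bigcup_mkord big_ord_recr/= -setDDl. Qed.

Let FD k : F (n0 + k)%N (D k).
Proof.
elim: k => [|k IH].
  by rewrite /D addn0 bigcup_mkord big_ord0 setD0.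
rewrite DS; apply: setD_wrt; last exact: measurable_wrt_fresh.
by apply: FS' IH; rewrite leq_add2l.
Qed.

(** Positivity gives its meaning to the division by (4 h)^2 in [lyapunov]; it persists because the
    height is constant during a stage. *)
Let height_D k t : D k t -> (0 < height (st (n0 + k) t))%R.
Proof.
elim: k => [|k IH].
  rewrite addn0 => -[/A_fresh[fr x_gt0] _].
  have -> // : height (st n0 t) = x n0 t.
  by case: (n0) fr => [//|n] /=; rewrite /step; case: ifP.
rewrite DS => -[/IH]; rewrite addnS /= /step; case: ifP => //= _ _.
Qed.

Let Lyap n t := lyapunov r m0 (st n t) (x n t).

Let Lyap_ge0 n t : (0 <= Lyap n t)%R.
Proof.
have [_ _ ? _ ?] := state_inv r m0 (x0^~ t) n.
exact: lyapunov_ge0.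
Qed.

Let mlyap n : measurable_wrt (F n) (fun t => lyapunov_cst r m0 (st n t)) /\
  measurable_wrt (F n) (fun t => lyapunov_lin r m0 (st n t)).
Proof.
have [mH mc mN _] := measurable_state n.
have minv2 : measurable_wrt (F n) (fun t => (4 * height (st n t)) ^- 2)%R.
  rewrite (_ : (fun t => _) = (fun t => ((4 * height (st n t)) `^ (-1)) ^+ 2)%R).
    apply: measurable_funX; apply: (measurableT_comp (measurable_powR _)).
    exact: measurable_funM.
  apply/funext => t; have [h0 _ _ _ _] := state_inv r m0 (x0^~ t) n.
  by rewrite powR_inv1 ?mulr_ge0// exprVn.
split; apply: measurable_sum => m; apply: measurable_funM => //.
- apply: measurable_funD; first exact: measurable_funM.
  by apply: measurable_funM => //; exact: measurable_funX.
- apply: measurable_funM => //; apply: measurable_funM => //.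
  by apply: measurable_funB => //; exact: measurable_funM.
Qed.

Let lyap_ge0 n t y : (0 <= y)%R -> (0 <= lyapunov r m0 (st n t) y)%R.
Proof.
have [_ _ ? _ ?] := state_inv r m0 (x0^~ t) n.
by move=> y0; exact: lyapunov_ge0.
Qed.

Let lin_ge0 n t : (0 <= lyapunov_lin r m0 (st n t))%R.
Proof.
have [_ _ rb _ _] := state_inv r m0 (x0^~ t) n.
apply: sumr_ge0 => m _; have /andP[_ ?] := rb m.
rewrite mulr_ge0 ?exprn_ge0// ?divr_ge0// ?(ltW (lt_trans _ r2))//.
by rewrite mulr_ge0 ?invr_ge0 ?sqr_ge0// mulr_ge0// subr_ge0.
Qed.

Let cst_ge0 n t : (0 <= lyapunov_cst r m0 (st n t))%R.
Proof.
have [_ _ _ _ c0] := state_inv r m0 (x0^~ t) n.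
apply: sumr_ge0 => m _.
rewrite mulr_ge0 ?exprn_ge0// ?divr_ge0// ?(ltW (lt_trans _ r2))//.
by apply: addr_ge0; apply: mulr_ge0; rewrite ?sqr_ge0 ?invr_ge0 ?sqr_ge0 ?exprn_ge0.
Qed.

(** The function is affine in the value of the path, with coefficients measurable at time [n]. Their
    nonnegativity keeps the argument within nonnegative integrals, so no integrability has to be
    checked. *)
Let lyap_martingale n B : F n B ->
  \int[mu]_(t in B) (lyapunov r m0 (st n t) (x n.+1 t))%:E =
  \int[mu]_(t in B) (lyapunov r m0 (st n t) (x n t))%:E.
Proof.
move=> FB; have [mcst mlin] := mlyap n; have mB := Fm FB.
have mcst' := measurable_wrt_fun (sF n) (@Fm n) mcst.
have mlin' := measurable_wrt_fun (sF n) (@Fm n) mlin.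
have mxT k : measurable_fun [set: T] (x k).
  exact: (measurable_wrt_fun (sF k) (@Fm k) (@mx k)).
have E (y : T -> R) : measurable_fun [set: T] y -> (forall t, (0 <= y t)%R) ->
    \int[mu]_(t in B) (lyapunov r m0 (st n t) (y t))%:E =
    \int[mu]_(t in B) (lyapunov_cst r m0 (st n t))%:E +
    \int[mu]_(t in B) (lyapunov_lin r m0 (st n t) * y t)%:E.
  move=> my y0; under eq_integral do rewrite lyapunovE EFinD.
  rewrite ge0_integralD//.
  - by move=> t _; rewrite lee_fin.
  - by apply: measurable_funTS; exact/measurable_EFinP.
  - by move=> t _; rewrite lee_fin mulr_ge0.
  - by apply: measurable_funTS; apply/measurable_EFinP; exact: measurable_funM.
rewrite !E//; congr (_ + _).
apply: (ge0_eq_integral_subalg_in (sF n) (@Fm n)) => // C FC _; exact: xE.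
Qed.

Let mD k : measurable (D k). Proof. exact: Fm (FD k). Qed.

Let mLyap n y : measurable_fun [set: T] y ->
  measurable_fun [set: T] (fun t => (lyapunov r m0 (st n t) (y t))%:E).
Proof.
move=> my; have [mcst mlin] := mlyap n; apply/measurable_EFinP.
under eq_fun do rewrite lyapunovE.
apply: measurable_funD; first exact: (measurable_wrt_fun (sF n) (@Fm n)).
by apply: measurable_funM => //; exact: (measurable_wrt_fun (sF n) (@Fm n)).
Qed.

(** First x n is replaced by x n.+1 in the integral over [D k]. Where the stage continues, recording
    the new value does not increase the Lyapunov function; where it ends, the function is at least
    [energy_cap]. *)
Let decay k : \int[mu]_(t in D k.+1) (Lyap (n0 + k.+1) t)%:E +
  (energy_cap r m0)%:E * mu (D k `\` D k.+1) <=
  \int[mu]_(t in D k) (Lyap (n0 + k) t)%:E.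
Proof.
rewrite -[leRHS]lyap_martingale// addnS; set n := (n0 + k)%N.
have mxT j : measurable_fun [set: T] (x j).
  exact: (measurable_wrt_fun (sF j) (@Fm j) (@mx j)).
have DkS : D k.+1 `<=` D k by rewrite DS; exact: subDsetl.
rewrite -[in leRHS](setDUK DkS) ge0_integral_setU//; last 4 first.
- exact: measurableD.
- by apply: measurable_funTS; exact: mLyap.
- by move=> t _; rewrite lee_fin lyap_ge0.
- by apply/disj_setPS; rewrite setDE setICA setICr setI0.
apply: leeD.
  apply: ge0_le_integral => //.
  - by move=> t _; rewrite lee_fin.
  - by apply: measurable_funTS; exact: mLyap.
  - by apply: measurable_funTS; exact: mLyap.
  - move=> t; rewrite DS => -[Dt]; rewrite lee_fin /Lyap addnS -/n /= /step.
    case: ifP => // _ _; apply: lyapunov_moved => //; exact: (height_D Dt).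
rewrite -integral_cst; last exact: measurableD.
apply: ge0_le_integral => //.
- exact: measurableD.
- by move=> t _; rewrite lee_fin (le_trans _ (energy_cap_ge1 r2 m0_gt0)).
- by apply: measurable_funTS; exact: mLyap.
- move=> t [Dt]; rewrite DS => nD; rewrite lee_fin.
  have [_ _ ? _ ?] := state_inv r m0 (x0^~ t) n.
  apply: lyapunov_crit => //; first exact: (height_D Dt).
  apply: contra_notT nD => ncr; split => //.
  by rewrite /= addnS /= /step -/n (negbTE ncr).
Qed.

(* A stage that starts at a positive value ends with conditional probability at
   most one half. *)
Lemma stage_end_half k : mu (A `\` D k) <= 2^-1%:E * mu A.
Proof.
have cap1 := energy_cap_ge1 r2 m0_gt0; set cap := energy_cap r m0 in cap1.
have mA := Fm FA.
(* Optional stopping by hand: by [decay], the Lyapunov integral over the running part plus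
   [energy_cap] times the mass already ended does not increase with [k], and it starts at no more
   than half of [energy_cap] times the mass of [A]. *)
suff H : \int[mu]_(t in D k) (Lyap (n0 + k) t)%:E + cap%:E * mu (A `\` D k) <=
    (cap / 2)%:E * mu A.
  have : cap%:E * mu (A `\` D k) <= (cap / 2)%:E * mu A.
    rewrite (le_trans _ H)// leeDr// integral_ge0// => t _.
    by rewrite lee_fin.
  rewrite EFinM -muleA lee_pmul2l ?lte_fin//.
  by rewrite (lt_le_trans _ cap1).
elim: k => [|k IH].
  have -> : D 0 = A by rewrite /D bigcup_mkord big_ord0 setD0.
  rewrite setDv measure0 mule0 adde0 addn0 -integral_cst//.
  apply: ge0_le_integral => //.
  - by move=> t _; rewrite lee_fin.
  - by apply: measurable_funTS; apply: mLyap; exact: (measurable_wrt_fun (sF _) (@Fm _)).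
  move=> t /A_fresh[fr x_gt0]; rewrite lee_fin /Lyap.
  have -> : st n0 t = new_stage (x n0 t).
    by case: (n0) fr => [//|n] /=; rewrite /step; case: ifP.
  exact: lyapunov_new.
apply: le_trans IH.
have -> : A `\` D k.+1 = (A `\` D k) `|` (D k `\` D k.+1).
  apply/seteqP; split => t /=.
    move=> [At nDS]; have [Dt|nD] := pselect (D k t); [right|left] => //.
  move=> [[At nD]|[Dt nDS]]; split => //; last by case: Dt.
  by rewrite DS => -[].
rewrite measureU//; [| exact: measurableD | exact: measurableD |]; last first.
  by apply/seteqP; split => // t [[_ nD] [Dt _]].
rewrite muleDr ?ge0_adde_def ?inE// addeC -addeA addeC leeD2r//.
by rewrite addeC; exact: decay.
Qed.

End from_time.
End stage_decay.

(** * Integrals of nonnegative real functions *)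

Section real_integrals.
Context d (T : measurableType d) (R : realType) (mu : {measure set T -> \bar R}).
Context (D : set T) (mD : measurable D).
Implicit Types f g : T -> R.

Lemma measurable_fun_EFin f : measurable_fun [set: T] f ->
  measurable_fun D (fun t => (f t)%:E).
Proof. by move=> mf; apply: measurable_funTS; exact/measurable_EFinP. Qed.

Lemma ge0_le_integral_EFin f g :
  measurable_fun [set: T] f -> measurable_fun [set: T] g ->
  (forall t, D t -> (0 <= f t)%R) -> (forall t, D t -> (f t <= g t)%R) ->
  \int[mu]_(t in D) (f t)%:E <= \int[mu]_(t in D) (g t)%:E.
Proof.
move=> mf mg f0 fg; apply: ge0_le_integral => //.
- exact: measurable_fun_EFin.
- exact: measurable_fun_EFin.
Qed.

Lemma ge0_integralD_EFin f g :
  measurable_fun [set: T] f -> measurable_fun [set: T] g ->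
  (forall t, D t -> (0 <= f t)%R) -> (forall t, D t -> (0 <= g t)%R) ->
  \int[mu]_(t in D) (f t + g t)%:E =
  \int[mu]_(t in D) (f t)%:E + \int[mu]_(t in D) (g t)%:E.
Proof.
move=> mf mg f0 g0; under eq_integral do rewrite EFinD.
rewrite ge0_integralD//.
- exact: measurable_fun_EFin.
- exact: measurable_fun_EFin.
Qed.

Lemma ge0_integralZl_real (k : R) f : (0 <= k)%R ->
  measurable_fun [set: T] f -> (forall t, D t -> (0 <= f t)%R) ->
  \int[mu]_(t in D) (k * f t)%:E = k%:E * \int[mu]_(t in D) (f t)%:E.
Proof.
move=> k0 mf f0; under eq_integral do rewrite EFinM.
rewrite ge0_integralZl_EFin//; exact: measurable_fun_EFin.
Qed.

(** Meant for truncations at level [j], each exact at a given point from some [j] on; hence eventual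
    equality in place of convergence. *)
Lemma ge0_integral_limit_le f (g : nat -> T -> R) C :
  (forall j, measurable_fun [set: T] (g j)) ->
  (forall j t, D t -> (0 <= g j t)%R) ->
  (forall t, D t -> {homo g^~ t : i j / (i <= j)%N >-> (i <= j)%R}) ->
  (forall t, D t -> \forall j \near \oo, g j t = f t) ->
  (forall j, \int[mu]_(t in D) (g j t)%:E <= C) ->
  \int[mu]_(t in D) (f t)%:E <= C.
Proof.
move=> mg g0 gnd glim gC.
have cvgg : \int[mu]_(t in D) (g j t)%:E @[j --> \oo] -->
    \int[mu]_(t in D) limn (fun j => (g j t)%:E).
  apply: cvg_monotone_convergence => //.
  by move=> j; exact: measurable_fun_EFin.
have -> : \int[mu]_(t in D) (f t)%:E = \int[mu]_(t in D) limn (fun j => (g j t)%:E).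
  apply: eq_integral => t /set_mem Dt; apply/esym/cvg_lim => //.
  by apply: cvg_near_cst; apply: filterS (glim t Dt) => j ->.
rewrite -(cvg_lim _ cvgg)//; apply: lime_le; first by apply/cvg_ex; eexists; exact: cvgg.
exact: nearW.
Qed.

End real_integrals.

(** * Doob's maximal inequality for the measure with density [s] *)

Section doob.
Context d (T : measurableType d) (R : realType) (mu : probability T R).
Context (F : nat -> set (set T)) (hF : filtration F).
Context (s : T -> R) (ms : measurable_fun [set: T] s) (s0 : forall t, (0 < s t)%R).
Context (B : set T) (FB : F 0%N B) (Bfin : \int[mu]_(t in B) (s t)%:E < +oo).
Context (q : R) (q1 : (1 < q)%R).
Context (h : T -> R) (mh : measurable_fun [set: T] h) (h0 : forall t, (0 <= h t)%R).
Context (hn : nat -> T -> R) (hn0 : forall n t, (0 <= hn n t)%R).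
Hypothesis mhn : forall n, measurable_wrt (F n) (hn n).
Hypothesis hnE : forall n A, F n A ->
  \int[mu]_(t in A) (hn n t * s t)%:E = \int[mu]_(t in A) (h t * s t)%:E.

(** The cap makes the weighted integral of the maximum over [B] finite, which is necessary for
    absorbing a part of it in [doob_capped]. *)
Fixpoint capped_max (K : R) (y : nat -> R) n : R :=
  if n is n'.+1 then Num.max (capped_max K y n') (Num.min (y n) K)
  else Num.min (y 0%N) K.

Lemma capped_max_ge0 K y n : (0 <= K)%R -> (forall n, 0 <= y n)%R ->
  (0 <= capped_max K y n)%R.
Proof.
move=> K0 y0; elim: n => [|n IH] /=; first by rewrite le_min y0.
by rewrite le_max IH.
Qed.

Lemma capped_max_le K y n : (capped_max K y n <= K)%R.
Proof.
by elim: n => [|n IH] /=; rewrite ?ge_max ?IH/= ge_min lexx orbT.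
Qed.

(** If the maximum does not grow, both increments vanish. If it grows, [powR_increment] applies, and
    replacing the capped new value by [y n.+1] only enlarges the right-hand side. *)
Lemma capped_max_incr K y n : (0 <= K)%R -> (forall n, 0 <= y n)%R ->
  (capped_max K y n.+1 `^ q <= capped_max K y n `^ q + q / (q - 1) *
    (y n.+1 * (capped_max K y n.+1 `^ (q - 1) - capped_max K y n `^ (q - 1))))%R.
Proof.
move=> K0 y0 /=; set m := capped_max K y n.
have m0 : (0 <= m)%R by exact: capped_max_ge0.
have [_|lt] := leP (Num.min (y n.+1) K) m; first by rewrite subrr !mulr0 addr0.
apply: le_trans (powR_increment q1 m0 (ltW lt)) _.
have q1' := q1; rewrite lerD2l ler_wpM2l ?divr_ge0//; [lra|lra|].
rewrite ler_wpM2r ?ge_min ?lexx// subr_ge0; apply: ge0_le_powR => //; last exact: ltW.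
lra.
Qed.

Let sF n : sigma_algebra [set: T] (F n). Proof. by case: hF. Qed.
Let Fm n : F n `<=` measurable. Proof. by case: hF. Qed.
Let F0n n : F 0%N `<=` F n. Proof. by case: hF => _ _; apply. Qed.
Let mB : measurable B. Proof. exact: Fm FB. Qed.

Let cm K n t := capped_max K (hn^~ t) n.

Let mcm K n : measurable_wrt (F n) (cm K n).
Proof.
elim: n => [|n IH]; first exact: measurable_minr (@mhn _) (measurable_cst _).
apply: measurable_maxr; last exact: measurable_minr (@mhn _) (measurable_cst _).
by apply: measurable_wrtS IH; case: hF => _ _; apply.
Qed.

Let mcmT K n : measurable_fun [set: T] (cm K n).
Proof. exact: (measurable_wrt_fun (sF n) (@Fm n) (@mcm K n)). Qed.

Let mcmX K n e : measurable_fun [set: T] (fun t => cm K n t `^ e)%R.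
Proof. by apply: (measurableT_comp (measurable_powR _)). Qed.

Let mhnT n : measurable_fun [set: T] (hn n).
Proof. exact: (measurable_wrt_fun (sF n) (@Fm n) (@mhn n)). Qed.

Let cm0 K n t : (0 <= K)%R -> (0 <= cm K n t)%R.
Proof. by move=> K0; exact: capped_max_ge0. Qed.

Let c : R := q / (q - 1).
Let c0 : (0 <= c)%R. Proof. by rewrite divr_ge0 ?subr_ge0 ?ltW// (lt_trans _ q1). Qed.
Let qm0 : (0 <= q - 1)%R. Proof. by rewrite subr_ge0 ltW. Qed.

(** Summation by parts. The increment of the (q - 1)-th power is nonnegative and measurable at time
    [n.+1], so [pull] replaces [hn n.+1] by [h] next to it; with the same [h] at all times the
    increments telescope. *)
Let doob_step K n : (0 <= K)%R ->
  \int[mu]_(t in B) (cm K n t `^ q * s t)%:E <=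
  \int[mu]_(t in B) (c * cm K n t `^ (q - 1) * (h t * s t))%:E.
Proof.
move=> K0; have s0' t : (0 <= s t)%R by exact: ltW.
have pull m (phi : T -> R) : measurable_wrt (F m) phi -> (forall t, 0 <= phi t)%R ->
    \int[mu]_(t in B) (phi t * (hn m t * s t))%:E =
    \int[mu]_(t in B) (phi t * (h t * s t))%:E.
  move=> mphi phi0; apply: (ge0_eq_integral_subalg_in (sF m) (@Fm m)) => //.
  - exact: measurable_funM.
  - exact: measurable_funM.
  - by move=> t; rewrite mulr_ge0.
  - by move=> t; rewrite mulr_ge0.
  - by move=> A FA _; exact: hnE.
  - exact: F0n FB.
have mX m e : measurable_wrt (F m) (fun t => cm K m t `^ e)%R.
  by apply: (measurableT_comp (measurable_powR _)); exact: mcm.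
elim: n => [|n IH].
  rewrite -(pull 0%N); last 2 first.
  - by apply: measurable_funM => //; exact: mX.
  - by move=> t; rewrite mulr_ge0// powR_ge0.
  apply: ge0_le_integral_EFin => //.
  - exact: measurable_funM.
  - by do 2 apply: measurable_funM => //; exact: measurable_funM.
  - by move=> t _; rewrite mulr_ge0// powR_ge0.
  - move=> t _; rewrite mulrA ler_wpM2r//.
    have m0 := cm0 0 t K0; rewrite -(mulr_powRB1 m0) ?(lt_trans _ q1)//.
    rewrite mulrAC ler_wpM2r ?powR_ge0//.
    have hm : (cm K 0 t <= hn 0 t)%R by rewrite /cm /= ge_min lexx.
    rewrite (le_trans hm)// ler_peMl// /c ler_pdivlMr ?subr_gt0// mul1r gerDl.
    by rewrite oppr_le0.
pose D t := (c * (cm K n.+1 t `^ (q - 1) - cm K n t `^ (q - 1)))%R.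
have D0 t : (0 <= D t)%R.
  rewrite mulr_ge0// subr_ge0; apply: ge0_le_powR => //; first exact: cm0.
  by rewrite /cm /= le_max lexx.
have mD : measurable_wrt (F n.+1) D.
  apply: measurable_funM => //; apply: measurable_funB; first exact: mX.
  by apply: measurable_wrtS (mX n _); case: hF => _ _; apply.
have mDT := measurable_wrt_fun (sF _) (@Fm _) mD.
apply: (@le_trans _ _ (\int[mu]_(t in B)
    (cm K n t `^ q * s t + D t * (hn n.+1 t * s t))%:E)).
  apply: ge0_le_integral_EFin => //.
  - exact: measurable_funM.
  - by apply: measurable_funD; apply: measurable_funM => //; exact: measurable_funM.
  - by move=> t _; rewrite mulr_ge0// powR_ge0.
  - move=> t _; rewrite mulrA -mulrDl ler_wpM2r//.
    have := @capped_max_incr K (hn^~ t) n K0 (hn0^~ t).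
    by rewrite /D -!mulrA [(hn n.+1 t * _)%R]mulrC.
rewrite ge0_integralD_EFin; last 5 first.
- exact: mB.
- exact: measurable_funM.
- by apply: measurable_funM => //; exact: measurable_funM.
- by move=> t _; rewrite mulr_ge0// powR_ge0.
- by move=> t _; apply: mulr_ge0; [exact: D0|exact: mulr_ge0].
rewrite (pull _ _ mD D0).
apply: (le_trans (leeD2r _ IH)).
rewrite -ge0_integralD_EFin; last 5 first.
- exact: mB.
- by do 2 apply: measurable_funM => //; exact: measurable_funM.
- by apply: measurable_funM => //; exact: measurable_funM.
- by move=> t _; apply: mulr_ge0; apply: mulr_ge0; rewrite ?powR_ge0.
- by move=> t _; apply: mulr_ge0; [exact: D0|exact: mulr_ge0].
apply: ge0_le_integral_EFin => //.
- apply: measurable_funD; last by apply: measurable_funM => //; exact: measurable_funM.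
  by do 2 apply: measurable_funM => //; exact: measurable_funM.
- by do 2 apply: measurable_funM => //; exact: measurable_funM.
- move=> t _; apply: addr_ge0; apply: mulr_ge0; rewrite ?D0//; apply: mulr_ge0; by rewrite ?powR_ge0.
- by move=> t _; rewrite -mulrDl /D -mulrDr subrKC.
Qed.

(** The constant of [mul_absorb] with K = e / (e - 1) and parameter 1/2; the leading 2 comes from
    absorbing half of the left-hand side. *)
Definition doob_cst (e : R) : R := (2 * ((e / (e - 1)) `^ e * 2^-1 `^ (1 - e)))%R.

Lemma doob_capped K n : (0 <= K)%R ->
  \int[mu]_(t in B) (cm K n t `^ q * s t)%:E <=
  (doob_cst q)%:E * \int[mu]_(t in B) (h t `^ q * s t)%:E.
Proof.
move=> K0; have s0' t : (0 <= s t)%R by exact: ltW.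
have mhX : measurable_fun [set: T] (fun t => h t `^ q)%R.
  by apply: (measurableT_comp (measurable_powR _)).
set a := \int[mu]_(t in B) _.
set b := \int[mu]_(t in B) (h t `^ q * s t)%:E.
set k := (c `^ q * 2^-1 `^ (1 - q))%R.
have k0 : (0 <= k)%R by rewrite mulr_ge0 ?powR_ge0.
have a_fin : a \is a fin_num.
  rewrite ge0_fin_numE; last by apply: integral_ge0 => t _; rewrite lee_fin mulr_ge0 ?powR_ge0.
  apply: (@le_lt_trans _ _ (\int[mu]_(t in B) (K `^ q * s t)%:E)).
    apply: ge0_le_integral_EFin => //.
    - exact: measurable_funM.
    - exact: measurable_funM.
    - by move=> t _; rewrite mulr_ge0 ?powR_ge0.
    - move=> t _; rewrite ler_wpM2r//; apply: ge0_le_powR => //.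
      + by rewrite (le_trans _ (ltW q1)).
      + exact: cm0.
      + exact: capped_max_le.
  rewrite ge0_integralZl_real ?powR_ge0//.
  by rewrite lte_mul_pinfty ?lee_fin ?powR_ge0.
have ab : a <= 2^-1%:E * a + k%:E * b.
  apply: (le_trans (doob_step n K0)).
  rewrite -ge0_integralZl_real//; last 2 first.
  - exact: measurable_funM.
  - by move=> t _; rewrite mulr_ge0 ?powR_ge0.
  rewrite -[X in _ + X]ge0_integralZl_real//; last 2 first.
  - exact: measurable_funM.
  - by move=> t _; rewrite mulr_ge0 ?powR_ge0.
  rewrite -ge0_integralD_EFin//; last 4 first.
  - by do 2 apply: measurable_funM => //.
  - by do 2 apply: measurable_funM => //.
  - by move=> t _; rewrite !mulr_ge0 ?powR_ge0.
  - by move=> t _; rewrite !mulr_ge0 ?powR_ge0.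
  apply: ge0_le_integral_EFin => //.
  - by do 2 apply: measurable_funM => //; exact: measurable_funM.
  - by apply: measurable_funD; do 2 apply: measurable_funM => //.
  - by move=> t _; apply: mulr_ge0; apply: mulr_ge0; rewrite ?powR_ge0.
  - move=> t _; rewrite !mulrA -mulrDl ler_wpM2r//.
    have := @mul_absorb _ q c (2^-1)%R (h t) (cm K n t `^ (q - 1)) q1 c0 _ (h0 t) (powR_ge0 _ _).
    have qq : ((q - 1) * (q / (q - 1)) = q)%R.
      by rewrite mulrCA mulfV ?mulr1// gt_eqF// subr_gt0.
    rewrite -powRrM qq invr_gt0 ltr0n => /(_ isT).
    by rewrite -/k [(h t * _)%R]mulrC mulrA.
have b0 : 0 <= b by apply: integral_ge0 => t _; rewrite lee_fin mulr_ge0 ?powR_ge0.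
rewrite /doob_cst -/c -/k EFinM -muleA.
case: b b0 ab => [b b0| |//].
  rewrite -(fineK a_fin) -!EFinM -EFinD !lee_fin; lra.
(* With an infinite integral of [h] the bound is trivial, except for a zero coefficient, where 0
   times +oo is 0. *)
have [->|kn0] := eqVneq k 0%R.
  rewrite !mul0e adde0 mule0 -(fineK a_fin) -EFinM !lee_fin; lra.
by move=> _ _; rewrite gt0_muley ?lte_fin ?lt0r ?kn0// gt0_muley ?leey.
Qed.

Fixpoint path_max (y : nat -> R) n : R :=
  if n is n'.+1 then Num.max (path_max y n') (y n) else y 0%N.

Lemma capped_maxE K y n : capped_max K y n = Num.min (path_max y n) K.
Proof. by elim: n => [//|n IH] /=; rewrite IH min_maxl. Qed.

Lemma le_path_max y n k : (k <= n)%N -> (y k <= path_max y n)%R.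
Proof.
elim: n => [|n IH]; first by rewrite leqn0 => /eqP ->.
rewrite leq_eqVlt => /predU1P[->|kn] /=; first by rewrite le_max lexx orbT.
by rewrite le_max IH.
Qed.

Lemma measurable_path_max n : measurable_fun [set: T] (fun t => path_max (hn^~ t) n).
Proof. by elim: n => [|n IH]; [exact: mhnT|exact: measurable_maxr]. Qed.

Lemma doob n : \int[mu]_(t in B) (path_max (hn^~ t) n `^ q * s t)%:E <=
  (doob_cst q)%:E * \int[mu]_(t in B) (h t `^ q * s t)%:E.
Proof.
have pm0 t : (0 <= path_max (hn^~ t) n)%R by exact: le_trans (le_path_max _ (leq0n n)).
apply: (@ge0_integral_limit_le _ _ _ _ _ mB _ (fun j t => cm j%:R n t `^ q * s t)%R).
- by move=> j; exact: measurable_funM.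
- by move=> j t _; rewrite mulr_ge0 ?powR_ge0// ltW.
- move=> t _ i j ij; rewrite ler_wpM2r ?(ltW (s0 t))//; apply: ge0_le_powR.
  + by rewrite ltW// (lt_trans _ q1).
  + exact: cm0.
  + by rewrite /cm !capped_maxE le_min !ge_min lexx/= ler_nat ij orbT.
- move=> t _; near=> j; rewrite /cm capped_maxE (min_idPl _)//.
  near: j; exact: nbhs_infty_ger.
- by move=> j; exact: doob_capped.
Unshelve. all: by end_near. Qed.

End doob.

Lemma measurable_fun_inv d (U : measurableType d) (R : realType) (f : U -> R) :
  measurable_fun [set: U] f -> (forall t, (0 <= f t)%R) ->
  measurable_fun [set: U] (fun t => (f t)^-1)%R.
Proof.
move=> mf f0; rewrite (_ : (fun t => _) = (fun t => f t `^ (-1))%R).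
  exact: (measurableT_comp (measurable_powR _) mf).
by apply/funext => t; rewrite powR_inv1.
Qed.

(** * A conditional Markov inequality *)

Section conditional_markov.
Context d (T : measurableType d) (R : realType) (mu : probability T R).
Context (G : set (set T)) (sG : sigma_algebra [set: T] G) (Gm : G `<=` measurable).
Context (v vG : T -> R) (mv : measurable_fun [set: T] v) (v0 : forall t, (0 < v t)%R).
Context (mvG : measurable_wrt G vG) (vG0 : forall t, (0 < vG t)%R).
Hypothesis vGE : forall A, G A ->
  \int[mu]_(t in A) (vG t)%:E = \int[mu]_(t in A) (v t)%:E.

(** The integral of v / (8 vG) over [A] is exactly mu A / 8, because 1 / vG is [G]-measurable. *)
Lemma conditional_markov A : G A ->
  mu (A `&` [set t | 8 * vG t < v t]%R) <= (8^-1)%:E * mu A.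
Proof.
move=> GA; have mA := Gm GA.
have mvGT := measurable_wrt_fun sG Gm mvG.
have mS : measurable [set t | 8 * vG t < v t]%R.
  rewrite (_ : [set t | _] = (fun t => 8 * vG t < v t)%R @^-1` [set true]); last first.
    by apply/seteqP; split => t /=.
  rewrite -[X in measurable X]setTI; apply: measurable_fun_ltr => //.
  exact: measurable_funM.
have vG0' t : (0 <= (vG t)^-1)%R by rewrite invr_ge0 ltW.
have miv : measurable_fun [set: T] (fun t => (vG t)^-1)%R.
  by apply: measurable_fun_inv => // t; exact: ltW.
have v0' t : (0 <= v t)%R by exact: ltW.
have mAS : measurable (A `&` [set t | 8 * vG t < v t]%R) by exact: measurableI.
rewrite -[leLHS]mul1e -integral_cst//.
apply: (@le_trans _ _ (\int[mu]_(t in A `&` [set t | 8 * vG t < v t]%R)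
    (8^-1 * ((vG t)^-1 * v t))%:E)).
  apply: ge0_le_integral_EFin => //.
  - by apply: measurable_funM => //; exact: measurable_funM.
  - move=> t [_ /= /ltW le8].
    by rewrite mulrCA -ler_pdivrMl ?invr_gt0// invrK mulr1 ler_pdivlMl.
apply: (@le_trans _ _ (\int[mu]_(t in A) (8^-1 * ((vG t)^-1 * v t))%:E)).
  apply: ge0_subset_integral => //.
  - apply: measurable_fun_EFin.
    by apply: measurable_funM => //; exact: measurable_funM.
  - by move=> t _; rewrite lee_fin !mulr_ge0.
rewrite ge0_integralZl_real//; last 2 first.
- exact: measurable_funM.
- by move=> t _; rewrite mulr_ge0.
rewrite lee_pmul2l ?lte_fin ?invr_gt0//.
have mivG : measurable_wrt G (fun t => (vG t)^-1)%R.
  by apply: measurable_fun_inv => // t; exact: ltW.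
rewrite -(@ge0_eq_integral_subalg_in _ _ _ mu G sG Gm A vG v)//; last 2 first.
- by move=> t; exact: ltW.
- by move=> C GC _; exact: vGE.
under eq_integral do rewrite mulVf ?gt_eqF//.
by rewrite integral_cst// mul1e.
Qed.

End conditional_markov.

(** * The weighted bound for sparse sums *)

Section sparse_bound.
Context d (T : measurableType d) (R : realType) (mu : probability T R).
Context (F : nat -> set (set T)) (hF : filtration F).
Context (p : R) (p1 : (1 < p)%R).
Context (w : T -> R) (mw : measurable_fun [set: T] w) (w0 : forall t, (0 < w t)%R).

Let sg t := (w t `^ (- (p - 1)^-1))%R.

Context (wn sn : nat -> T -> R).
Context (wn0 : forall n t, (0 < wn n t)%R) (sn0 : forall n t, (0 < sn n t)%R).
Context (mwn : forall n, measurable_wrt (F n) (wn n)).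
Context (msn : forall n, measurable_wrt (F n) (sn n)).
Hypothesis wnE : forall n A, F n A ->
  \int[mu]_(t in A) (wn n t)%:E = \int[mu]_(t in A) (w t)%:E.
Hypothesis snE : forall n A, F n A ->
  \int[mu]_(t in A) (sn n t)%:E = \int[mu]_(t in A) (sg t)%:E.
Context (Q : R) (Q0 : (0 < Q)%R).
Hypothesis wsQ : forall n t, (wn n t * sn n t `^ (p - 1) <= Q)%R.

Context (X : T -> R) (mX : measurable_fun [set: T] X) (X0 : forall t, (0 <= X t)%R).
Context (x : nat -> T -> R) (x0 : forall n t, (0 <= x n t)%R).
Context (mx : forall n, measurable_wrt (F n) (x n)).
Hypothesis xE : forall n A, F n A ->
  \int[mu]_(t in A) (x n t)%:E = \int[mu]_(t in A) (X t)%:E.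

Context (N : nat) (S E : nat -> set T).
Context (FS : forall n, F n (S n)) (mE : forall n, measurable (E n)).
Hypothesis E_disj : forall i j t, (i <= N)%N -> (j <= N)%N -> E i t -> E j t -> i = j.
Hypothesis half : forall n A, (n <= N)%N -> F n A -> A `<=` S n ->
  mu A <= 2%:E * mu (A `&` E n).

Let sF n : sigma_algebra [set: T] (F n). Proof. by case: hF. Qed.
Let Fm n : F n `<=` measurable. Proof. by case: hF. Qed.
Let F0n n : F 0%N `<=` F n. Proof. by case: hF => _ _; apply. Qed.
Let FT n f (mf : measurable_wrt (F n) f) : measurable_fun [set: T] (f : T -> R) :=
  measurable_wrt_fun (sF n) (@Fm n) mf.

Let p0 : (0 < p)%R. Proof. exact: lt_trans p1. Qed.
Let pm0 : (0 < p - 1)%R. Proof. by rewrite subr_gt0. Qed.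
Let pi0 : (0 < p^-1)%R. Proof. by rewrite invr_gt0. Qed.

Let sg0 t : (0 < sg t)%R. Proof. exact: powR_gt0. Qed.
Let msg : measurable_fun [set: T] sg.
Proof. exact: (measurableT_comp (measurable_powR _)). Qed.

Let good n := [set t | sg t <= 8 * sn n t]%R `&` [set t | w t <= 8 * wn n t]%R.

Let mgood n : measurable (good n).
Proof.
have mset (f g : T -> R) : measurable_fun [set: T] f -> measurable_fun [set: T] g ->
    measurable [set t | f t <= g t]%R.
  move=> mf mg.
  rewrite (_ : [set t | _] = (fun t => f t <= g t)%R @^-1` [set true]); last first.
    by apply/seteqP; split => t /=.
  by rewrite -[X in measurable X]setTI; exact: measurable_fun_ler.
by apply: measurableI; apply: mset => //; apply: measurable_funM => //; exact: FT.
Qed.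

(** At least half of [A] lies in [E n], and each of the two sets where a weight exceeds 8 times its
    average takes at most 1/8: there remains 1/2 - 1/8 - 1/8. *)
Lemma quarter n A : (n <= N)%N -> F n A -> A `<=` S n ->
  mu A <= 4%:E * mu (A `&` (E n `&` good n)).
Proof.
move=> nN FA AS; have mA := Fm FA.
have mset (f c : T -> R) : measurable_fun [set: T] f -> measurable_fun [set: T] c ->
    measurable [set t | 8 * c t < f t]%R.
  move=> mf mc.
  rewrite (_ : [set t | _] = (fun t => 8 * c t < f t)%R @^-1` [set true]); last first.
    by apply/seteqP; split => t /=.
  rewrite -[X in measurable X]setTI; apply: measurable_fun_ltr => //.
  exact: measurable_funM.
have m1 := conditional_markov (sF n) (@Fm n) msg sg0 (@msn n) (sn0 n) (@snE n) FA.
have m2 := conditional_markov (sF n) (@Fm n) mw w0 (@mwn n) (wn0 n) (@wnE n) FA.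
have mm1 := mset _ _ msg (FT (@msn n)); have mm2 := mset _ _ mw (FT (@mwn n)).
set B1 := [set t | 8 * sn n t < sg t]%R in m1 mm1.
set B2 := [set t | 8 * wn n t < w t]%R in m2 mm2.
set C := A `&` (E n `&` good n).
have mC : measurable C by apply: measurableI => //; exact: measurableI.
have cover : A `&` E n `<=` (C `|` (A `&` B1)) `|` (A `&` B2).
  move=> t [At Et]; have [s8|s8] := leP (sg t) (8 * sn n t)%R; last by left; right.
  have [w8|w8] := leP (w t) (8 * wn n t)%R; last by right.
  by left; left.
have : mu (A `&` E n) <= mu C + mu (A `&` B1) + mu (A `&` B2).
  apply: (@le_trans _ _ (mu ((C `|` (A `&` B1)) `|` (A `&` B2)))).
    apply: le_measure; rewrite ?inE//; first exact: measurableI.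
    by apply: measurableU; [apply: measurableU => //|]; exact: measurableI.
  apply: (@le_trans _ _ (mu (C `|` (A `&` B1)) + mu (A `&` B2))).
    apply: measureU2; last exact: measurableI.
    by apply: measurableU => //; exact: measurableI.
  by rewrite leeD2r//; apply: measureU2 => //; exact: measurableI.
have := half nN FA AS; move: m1 m2.
have fA := fin_num_measure mu A mA; have fC := fin_num_measure mu C mC.
have f1 := fin_num_measure mu _ (measurableI _ _ mA mm1).
have f2 := fin_num_measure mu _ (measurableI _ _ mA mm2).
have f3 := fin_num_measure mu _ (measurableI _ _ mA (mE n)).
rewrite -(fineK fA) -(fineK fC) -(fineK f1) -(fineK f2) -(fineK f3).
rewrite -!EFinD -!EFinM !lee_fin; lra.
Qed.

Let gam := Num.max 1%R (p - 1)^-1%R.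
(** The 4 is the loss in [quarter]; the rest is the constant of [weight_product]. *)
Let K : R := (4 * (8 `^ (p + (p - 1)^-1) * Q `^ gam))%R.
Let p' : R := (p / (p - 1))%R.
(** Chosen so that [e * doob_cst p'] is at most 1/2; the added 1 keeps the denominator positive. *)
Let e : R := (2 * (doob_cst p' + 1))^-1%R.

Let p'1 : (1 < p')%R.
Proof. by rewrite ltr_pdivlMr// mul1r gtrDl oppr_lt0. Qed.
Let p'0 : (0 < p')%R. Proof. exact: lt_trans p'1. Qed.

Lemma doob_cst_ge0 q : (0 <= doob_cst q :> R)%R.
Proof. by rewrite /doob_cst !mulr_ge0 ?powR_ge0. Qed.

Let e0 : (0 < e)%R.
Proof. by rewrite invr_gt0 mulr_gt0// ltr_wpDl ?doob_cst_ge0. Qed.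
Let K0 : (0 <= K)%R. Proof. by rewrite !mulr_ge0 ?powR_ge0. Qed.

Let sgX t : (sg t `^ (1 - p) = w t)%R.
Proof.
rewrite -powRrM (_ : (- (p - 1)^-1 * (1 - p) = 1)%R) ?powRr1 ?(ltW (w0 t))//.
by field; rewrite gt_eqF.
Qed.

Let cap (b : R) t := Num.min (\sum_(n < N.+1) \1_(S n) t * x n t)%R b.

Let sum0 t : (0 <= \sum_(n < N.+1) \1_(S n) t * x n t)%R.
Proof. by apply: sumr_ge0 => n _; rewrite mulr_ge0. Qed.

Let cap0 b t : (0 <= b)%R -> (0 <= cap b t)%R.
Proof. by move=> b0; rewrite le_min sum0. Qed.

Let mS n : measurable (S n). Proof. exact: Fm (FS n). Qed.

Let msum : measurable_fun [set: T] (fun t => \sum_(n < N.+1) \1_(S n) t * x n t)%R.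
Proof.
apply: measurable_sum => n; apply: measurable_funM; last exact: FT (@mx n).
exact: measurable_indic.
Qed.

Let mcap b : measurable_fun [set: T] (cap b).
Proof. exact: measurable_minr. Qed.

Let mcapX b r : measurable_fun [set: T] (fun t => cap b t `^ r)%R.
Proof. exact: (measurableT_comp (measurable_powR _) (mcap b)). Qed.

Section truncated.
Context (b : R) (b0 : (0 <= b)%R).

(** A set of time 0 on which both weights have finite mass, as Doob's inequality requires. These
    sets exhaust the space as [b] grows, even when the weights are not integrable. *)
Let B := [set t | wn 0%N t <= b]%R `&` [set t | sn 0%N t <= b]%R.

Lemma trunc_set_wrt : F 0%N B.
Proof.
have mset (f : T -> R) : measurable_wrt (F 0%N) f -> F 0%N [set t | f t <= b]%R.
  move=> mf; rewrite (_ : [set t | _] = f @^-1` `]-oo, b]%classic); last first.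
    by apply/seteqP; split => t /=; rewrite in_itv.
  exact: (measurable_wrt_preimage (sF 0%N) mf).
rewrite -(measurable_subalgE (sF 0%N)); apply: measurableI;
  rewrite measurable_subalgE//; exact: mset.
Qed.

Let FB := trunc_set_wrt.
Let mB : measurable B. Proof. exact: Fm FB. Qed.

Let bounded_mass (v vn : T -> R) : measurable_wrt (F 0%N) vn ->
  (forall t, 0 < vn t)%R -> (forall t, B t -> vn t <= b)%R ->
  (forall A, F 0%N A -> \int[mu]_(t in A) (vn t)%:E = \int[mu]_(t in A) (v t)%:E) ->
  \int[mu]_(t in B) (v t)%:E < +oo.
Proof.
move=> mvn vn0 vnb vnE; rewrite -vnE//.
apply: (@le_lt_trans _ _ (\int[mu]_(t in B) (cst b t)%:E)).
  apply: ge0_le_integral_EFin => //; first exact: (FT mvn).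
  by move=> t _; exact: ltW.
have -> : \int[mu]_(t in B) (cst b t)%:E = b%:E * mu B.
  exact: (integral_cst mu mB b%:E).
by rewrite lte_mul_pinfty ?lee_fin// (le_lt_trans (probability_le1 _ mB)) ?ltry.
Qed.

Let Bw : \int[mu]_(t in B) (w t)%:E < +oo.
Proof. by apply: (bounded_mass (@mwn 0%N)) => [//|t []|A]; [|exact: wnE]. Qed.

Let Bsg : \int[mu]_(t in B) (sg t)%:E < +oo.
Proof. by apply: (bounded_mass (@msn 0%N)) => [//|t []|A]; [|exact: snE]. Qed.

(** The extremal function for duality: on [B] its p'-th power is the p-th power of the truncated
    sum. *)
Let g t := (\1_B t * cap b t `^ (p - 1))%R.

Let g0 t : (0 <= g t)%R. Proof. by rewrite mulr_ge0 ?powR_ge0. Qed.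

Let mg : measurable_fun [set: T] g.
Proof. by apply: measurable_funM => //; exact: measurable_indic. Qed.

Let w0' t : (0 <= w t)%R. Proof. exact: ltW. Qed.
Let sg0' t : (0 <= sg t)%R. Proof. exact: ltW. Qed.
Let wn0' n t : (0 <= wn n t)%R. Proof. exact: ltW. Qed.
Let sn0' n t : (0 <= sn n t)%R. Proof. exact: ltW. Qed.

Let igw : mu.-integrable [set: T] (EFin \o (fun t => g t * w t)%R).
Proof.
apply/integrableP; split; first by apply/measurable_EFinP; exact: measurable_funM.
rewrite (eq_integral (fun t => (g t * w t)%:E)); last first.
  by move=> t _; rewrite gee0_abs//= lee_fin mulr_ge0.
apply: (@le_lt_trans _ _ (\int[mu]_t (b `^ (p - 1) * (\1_B t * w t))%:E)).
  apply: ge0_le_integral_EFin => //.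
  - exact: measurable_funM.
  - by apply: measurable_funM => //; apply: measurable_funM.
  - by move=> t _; rewrite mulr_ge0.
  - move=> t _; rewrite mulrA ler_wpM2r// /g mulrC ler_wpM2r//.
    by apply: ge0_le_powR; rewrite ?cap0 ?(ltW pm0)// ge_min lexx orbT.
rewrite ge0_integralZl_real ?powR_ge0//; last 2 first.
- by apply: measurable_funM => //; exact: measurable_indic.
- by move=> t _; rewrite mulr_ge0.
under eq_integral do rewrite EFinM.
by rewrite ge0_integral_indic_mul lte_mul_pinfty ?lee_fin ?powR_ge0.
Qed.

(** Instead of a supremum over dual functions, the truncated sum is tested against its own extremal
    function [g]. Doob's inequality for [g] then returns at most half of the left-hand side, which
    is finite and is absorbed. *)
Lemma truncated_bound :
  \int[mu]_(t in B) (cap b t `^ p * w t)%:E <=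
  (2 * (K `^ p * e `^ (1 - p) * doob_cst p))%:E *
  \int[mu]_t (X t `^ p * w t)%:E.
Proof.
have gw0 t : (0 <= g t * w t)%R by rewrite mulr_ge0.
have /choice[v vP] n := condexp_integrable_ex (sF n) (@Fm n) igw gw0.
have mv n : measurable_wrt (F n) (v n) by case: (vP n).
have v0 n t : (0 <= v n t)%R by case: (vP n).
have vE n A : F n A ->
    \int[mu]_(t in A) (v n t)%:E = \int[mu]_(t in A) (g t * w t)%:E.
  by case: (vP n) => _ _; apply.
(* These are conditional expectations for changed measures: [Hn n] that of X / sg for sg mu, and
   [Gn n] that of [g] for w mu. *)
pose Hn n t := (x n t / sn n t)%R; pose Gn n t := (v n t / wn n t)%R.
have Hn0 n t : (0 <= Hn n t)%R by rewrite divr_ge0.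
have Gn0 n t : (0 <= Gn n t)%R by rewrite divr_ge0.
have mHn n : measurable_wrt (F n) (Hn n).
  by apply: measurable_funM; [exact: mx|apply: measurable_fun_inv => //; exact: msn].
have mGn n : measurable_wrt (F n) (Gn n).
  by apply: measurable_funM; [exact: mv|apply: measurable_fun_inv => //; exact: mwn].
have HnE n A : F n A -> \int[mu]_(t in A) (Hn n t * sg t)%:E =
    \int[mu]_(t in A) (X t / sg t * sg t)%:E.
  move=> FA; rewrite -(@ge0_eq_integral_subalg_in _ _ _ mu _ (sF n) (@Fm n) A (sn n) sg)//.
  - under eq_integral do rewrite divfK ?gt_eqF//.
    by rewrite xE//; under [RHS]eq_integral do rewrite divfK ?gt_eqF//.
  - exact: FT (@msn n).
  - by move=> C FC _; exact: snE.
have GnE n A : F n A -> \int[mu]_(t in A) (Gn n t * w t)%:E =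
    \int[mu]_(t in A) (g t * w t)%:E.
  move=> FA; rewrite -(@ge0_eq_integral_subalg_in _ _ _ mu _ (sF n) (@Fm n) A (wn n) w)//.
  - by under eq_integral do rewrite divfK ?gt_eqF//; exact: vE.
  - exact: FT (@mwn n).
  - by move=> C FC _; exact: wnE.
have misg : measurable_fun [set: T] (fun t => X t / sg t)%R.
  by apply: measurable_funM => //; exact: measurable_fun_inv.
have h0 t : (0 <= X t / sg t)%R by rewrite divr_ge0.
have doobH := doob hF msg sg0 FB Bsg p1 misg h0 Hn0 mHn HnE N.
have doobG := doob hF mw w0 FB Bw p'1 mg g0 Gn0 mGn GnE N.
have mMH := measurable_path_max hF mHn N.
have mMG := measurable_path_max hF mGn N.
set MH := fun t => path_max (Hn^~ t) N in mMH doobH.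
set MG := fun t => path_max (Gn^~ t) N in mMG doobG.
have MH0 t : (0 <= MH t)%R by exact: le_trans (Hn0 0%N t) (le_path_max _ (leq0n N)).
have MG0 t : (0 <= MG t)%R by exact: le_trans (Gn0 0%N t) (le_path_max _ (leq0n N)).
set J := \int[mu]_(t in B) (cap b t `^ p * w t)%:E.
pose a1 t := (MH t * sg t `^ p^-1)%R; pose a2 t := (MG t * w t `^ (1 - p^-1))%R.
have sum1 t : (\sum_(n < N.+1) \1_(E n `&` good n) t <= 1 :> R)%R.
  have [[n Ent]|nE] := pselect (exists n : 'I_N.+1, E n t); last first.
    rewrite big1 ?ler01// => n _; rewrite indicE memNset// => -[Ent _].
    by apply: nE; exists n.
  rewrite (bigD1 n)//= big1 ?addr0; first by rewrite indicE; case: (_ \in _).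
  move=> m mn; rewrite indicE memNset// => -[Emt _]; move/negP: mn; apply.
  by apply/eqP/val_inj; apply: (@E_disj m n t) => //; rewrite -ltnS.
have term n t : (n <= N)%N -> (\1_(E n `&` good n) t * (4 * (x n t * v n t)) <=
    \1_(E n `&` good n) t * (K * (MH t * MG t * (sg t `^ p^-1 * w t `^ (1 - p^-1)))))%R.
  move=> nN; rewrite indicE; have [/set_mem[Ent [ssn wwn]]|_] := boolP (t \in _); last by rewrite !mul0r.
  rewrite !mul1r.
  have -> : (4 * (x n t * v n t) = 4 * ((Hn n t * Gn n t) * (sn n t * wn n t)))%R.
    by rewrite /Hn /Gn; field; rewrite !gt_eqF.
  have HG : (Hn n t * Gn n t <= MH t * MG t)%R.
    by apply: ler_pM => //; [exact: (le_path_max (Hn^~ t) nN)|exact: (le_path_max (Gn^~ t) nN)].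
  have := weight_product p1 (w0 t) (wn0 n t) (sn0 n t) Q0 (wsQ n t) wwn ssn.
  rewrite -/(sg t) -/gam; set z := (sg t `^ p^-1 * _)%R; set c8 := (8 `^ _ * _)%R => swz.
  rewrite (_ : K * (MH t * MG t * z) = 4 * ((MH t * MG t) * (c8 * z)))%R; last first.
    by rewrite /K -/c8; ring.
  by rewrite ler_wpM2l//; apply: ler_pM => //; exact: mulr_ge0.
have mI (C : set T) : measurable C -> measurable_fun [set: T] (\1_C : T -> R).
  by move=> mC; exact: measurable_indic.
have JZ : J <= \int[mu]_(t in B) (K * (a1 t * a2 t))%:E.
  have mxT n := FT (@mx n); have mvT n := FT (@mv n).
  have mES n : measurable (E n `&` good n) by exact: measurableI.
  pose u n t := (\1_(S n) t * x n t * (g t * w t))%R.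
  pose u' n t := (\1_(E n `&` good n) t * (4 * (x n t * v n t)))%R.
  have mu_ n : measurable_fun [set: T] (u n).
    apply: measurable_funM; last exact: measurable_funM.
    by apply: measurable_funM => //; exact: mI.
  have mu'_ n : measurable_fun [set: T] (u' n).
    apply: measurable_funM; first exact: mI.
    by apply: measurable_funM => //; exact: measurable_funM.
  have u0 n t : (0 <= u n t)%R.
    by apply: mulr_ge0; [exact: mulr_ge0|exact: gw0].
  have u'0 n t : (0 <= u' n t)%R.
    by apply: mulr_ge0 => //; apply: mulr_ge0 => //; exact: mulr_ge0.
  (* First [g * w] is averaged to [v n], the other factors being measurable at time [n]; then the
     indicator of [S n] is replaced by 4 times that of the good part of [E n], by [quarter]. *)
  have uu' n : (n <= N)%N -> \int[mu]_(t in B) (u n t)%:E <= \int[mu]_(t in B) (u' n t)%:E.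
    move=> nN; have FBn := F0n n FB.
    have mSn : measurable_wrt (F n) (\1_(S n) : T -> R).
      by apply: measurable_indic; rewrite measurable_subalgE.
    rewrite -(@ge0_eq_integral_subalg_in _ _ _ mu _ (sF n) (@Fm n) B (v n)
      (fun t => g t * w t)%R)//; last 4 first.
    - exact: measurable_funM.
    - by move=> C FC _; exact: vE.
    - by apply: measurable_funM => //; exact: mx.
    - by move=> t _; exact: mulr_ge0.
    under eq_integral do rewrite -mulrA mulrC.
    have -> : \int[mu]_(t in B) (u' n t)%:E =
        \int[mu]_(t in B) (x n t * v n t * (4 * \1_(E n `&` good n) t))%:E.
      by apply: eq_integral => t _; congr EFin; rewrite /u'; ring.
    apply: (@ge0_le_integral_subalg_in _ _ _ mu _ (sF n) (@Fm n) B (\1_(S n))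
      (fun t => 4 * \1_(E n `&` good n) t)%R) => //.
    - by apply: measurable_funM => //; exact: mI.
    - move=> C FC _; have mC := Fm FC.
      rewrite ge0_integralZl_real//.
      rewrite !integral_indic//.
      have CS : F n (C `&` S n).
        rewrite -(measurable_subalgE (sF n)).
        by apply: measurableI; rewrite measurable_subalgE.
      rewrite [X in mu X <= _]setIC; apply: (le_trans (quarter nN CS _)); first exact: subIsetr.
      rewrite lee_wpmul2l ?lee_fin//; apply: le_measure; rewrite ?inE.
      + by apply: measurableI; [exact: measurableI|].
      + exact: measurableI.
      + by move=> t [[Ct _] EG].
    - by apply: measurable_funM; [exact: mx|exact: mv].
    - by move=> t _; exact: mulr_ge0.
  apply: (@le_trans _ _ (\int[mu]_(t in B) (\sum_(n < N.+1) u n t)%:E)).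
    apply: ge0_le_integral_EFin => //.
    - exact: measurable_funM.
    - exact: measurable_sum.
    - by move=> t _; rewrite mulr_ge0 ?powR_ge0.
    - move=> t Bt; rewrite -mulr_suml /g indicE mem_set// mul1r mulrA ler_wpM2r//.
      rewrite -(mulr_powRB1 (cap0 t b0) p0) ler_wpM2r ?powR_ge0//.
      by rewrite ge_min lexx.
  apply: (@le_trans _ _ (\int[mu]_(t in B) (\sum_(n < N.+1) u' n t)%:E)).
    have swap (y : nat -> T -> R) : (forall n, measurable_fun [set: T] (y n)) ->
        (forall n t, (0 <= y n t)%R) -> \int[mu]_(t in B) (\sum_(n < N.+1) y n t)%:E =
        \sum_(n < N.+1) \int[mu]_(t in B) (y n t)%:E.
      move=> my y0; under eq_integral do rewrite -sumEFin.
      rewrite ge0_integral_sum//; first by move=> n; exact: measurable_fun_EFin.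
      by move=> n t _; rewrite lee_fin.
    rewrite !swap//; apply: lee_sum => n _; apply: uu'.
    by rewrite -ltnS.
  have ma1 : measurable_fun [set: T] a1.
    by apply: measurable_funM => //; exact: (measurableT_comp (measurable_powR _)).
  have ma2 : measurable_fun [set: T] a2.
    by apply: measurable_funM => //; exact: (measurableT_comp (measurable_powR _)).
  apply: ge0_le_integral_EFin => //.
  - exact: measurable_sum.
  - by apply: measurable_funM => //; exact: measurable_funM.
  - by move=> t _; exact: sumr_ge0.
  - move=> t _; rewrite (_ : K * (a1 t * a2 t) =
        K * (MH t * MG t * (sg t `^ p^-1 * w t `^ (1 - p^-1))))%R; last first.
      by rewrite /a1 /a2; ring.
    set z := (K * _)%R.
    have z0 : (0 <= z)%R.
      by apply: mulr_ge0 => //; apply: mulr_ge0; apply: mulr_ge0; rewrite ?powR_ge0.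
    apply: (@le_trans _ _ (\sum_(n < N.+1) \1_(E n `&` good n) t * z)%R).
      by apply: ler_sum => n _; apply: term; rewrite -ltnS.
    by rewrite -mulr_suml ler_piMl.
have mMHX : measurable_fun [set: T] (fun t => MH t `^ p)%R.
  exact: (measurableT_comp (measurable_powR _) mMH).
have mMGX : measurable_fun [set: T] (fun t => MG t `^ p')%R.
  exact: (measurableT_comp (measurable_powR _) mMG).
have ma1 : measurable_fun [set: T] a1.
  by apply: measurable_funM => //; exact: (measurableT_comp (measurable_powR _)).
have ma2 : measurable_fun [set: T] a2.
  by apply: measurable_funM => //; exact: (measurableT_comp (measurable_powR _)).
have a10 t : (0 <= a1 t)%R by rewrite mulr_ge0 ?powR_ge0.
have a20 t : (0 <= a2 t)%R by rewrite mulr_ge0 ?powR_ge0.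
set c := (K `^ p * e `^ (1 - p))%R.
have c0 : (0 <= c)%R by rewrite mulr_ge0 ?powR_ge0.
have Jle : J <= (e * doob_cst p')%:E * J +
    (c * doob_cst p)%:E * \int[mu]_t (X t `^ p * w t)%:E.
  apply: (le_trans JZ).
  apply: (@le_trans _ _ (\int[mu]_(t in B)
      (e * (MG t `^ p' * w t) + c * (MH t `^ p * sg t))%:E)).
    apply: ge0_le_integral_EFin => //.
    - by apply: measurable_funM => //; exact: measurable_funM.
    - by apply: measurable_funD; apply: measurable_funM => //; exact: measurable_funM.
    - by move=> t _; apply: mulr_ge0 => //; exact: mulr_ge0.
    - move=> t _; have := mul_absorb p1 K0 e0 (a10 t) (a20 t).
      rewrite -/c /a1 /a2 !powRM ?powR_ge0//.
      rewrite -(powRrM (sg t)) -(powRrM (w t)).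
      rewrite mulVf ?(gt_eqF p0)// powRr1//.
      have -> : ((1 - p^-1) * (p / (p - 1)) = 1)%R.
        by field; rewrite !gt_eqF.
      by rewrite powRr1.
  rewrite ge0_integralD_EFin//; last 4 first.
  - by apply: measurable_funM => //; exact: measurable_funM.
  - by apply: measurable_funM => //; exact: measurable_funM.
  - by move=> t _; apply: mulr_ge0; [exact: ltW|rewrite mulr_ge0 ?powR_ge0].
  - by move=> t _; apply: mulr_ge0 => //; rewrite mulr_ge0 ?powR_ge0.
  rewrite ge0_integralZl_real//; last 3 first.
  - exact: ltW.
  - exact: measurable_funM.
  - by move=> t _; rewrite mulr_ge0 ?powR_ge0.
  rewrite ge0_integralZl_real//; last 2 first.
  - exact: measurable_funM.
  - by move=> t _; rewrite mulr_ge0 ?powR_ge0.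
  apply: leeD; rewrite [in leRHS]EFinM -muleA.
    apply: lee_wpmul2l; first by rewrite lee_fin ltW.
    apply: (le_trans doobG); apply: lee_wpmul2l; first by rewrite lee_fin doob_cst_ge0.
    rewrite le_eqVlt; apply/orP; left; apply/eqP.
    apply: eq_integral => t /set_mem Bt; congr (_ * _)%:E.
    rewrite /g indicE mem_set// mul1r -powRrM; congr (_ `^ _)%R.
    by rewrite mulrCA mulfV ?mulr1// gt_eqF.
  apply: lee_wpmul2l; first by rewrite lee_fin.
  apply: (le_trans doobH); apply: lee_wpmul2l; first by rewrite lee_fin doob_cst_ge0.
  have mXp : measurable_fun [set: T] (fun t => X t `^ p * w t)%R.
    apply: measurable_funM => //; exact: (measurableT_comp (measurable_powR _) mX).
  apply: (@le_trans _ _ (\int[mu]_(t in B) (X t `^ p * w t)%:E)).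
    rewrite le_eqVlt; apply/orP; left; apply/eqP.
    (* (X / sg)^p sg = X^p sg^(1 - p) = X^p w. *)
    apply: eq_integral => t _; rewrite -(sgX t) powRM// ?invr_ge0//.
    rewrite -mulrA -[((sg t)^-1)%R]powR_inv1// -powRrM mulN1r.
    rewrite -[in X in (_ * (_ * X))%R](powRr1 (sg0' t)) -powRD ?(gt_eqF (sg0 t)) ?implybT//.
    by rewrite addrC.
  apply: ge0_subset_integral => //; first exact/measurable_EFinP.
  by move=> t _; rewrite lee_fin mulr_ge0 ?powR_ge0.
have J_fin : J \is a fin_num.
  rewrite ge0_fin_numE; last by apply: integral_ge0 => t _; rewrite lee_fin mulr_ge0 ?powR_ge0.
  apply: (@le_lt_trans _ _ (\int[mu]_(t in B) (b `^ p * w t)%:E)).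
    apply: ge0_le_integral_EFin => //.
    - exact: measurable_funM.
    - exact: measurable_funM.
    - by move=> t _; rewrite mulr_ge0 ?powR_ge0.
    - move=> t _; rewrite ler_wpM2r//; apply: ge0_le_powR; rewrite ?cap0 ?(ltW p0)//.
      by rewrite ge_min lexx orbT.
  rewrite ge0_integralZl_real ?powR_ge0//.
  by rewrite lte_mul_pinfty ?lee_fin ?powR_ge0.
have eD : (e * doob_cst p' <= 2^-1)%R.
  rewrite /e; have := doob_cst_ge0 p'; move: (doob_cst p') => D D0.
  by rewrite mulrC ler_pdivrMr ?mulr_gt0 ?ltr_wpDl// mulKf ?pnatr_eq0// lerDl.
have J0 : 0 <= J by apply: integral_ge0 => t _; rewrite lee_fin mulr_ge0 ?powR_ge0.
have I0 : 0 <= \int[mu]_t (X t `^ p * w t)%:E.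
  by apply: integral_ge0 => t _; rewrite lee_fin mulr_ge0 ?powR_ge0.
have cD0 : (0 <= c * doob_cst p)%R by rewrite mulr_ge0 ?doob_cst_ge0.
move: Jle I0; case: (\int[mu]_t _) => [I| |//].
  rewrite -(fineK J_fin) -!EFinM -EFinD !lee_fin => Jle I0.
  have := ler_wpM2r (fine_ge0 J0) eD; lra.
have [->|kn0] := eqVneq (c * doob_cst p)%R 0%R.
  rewrite !mul0e adde0 mulr0 mul0e => Jle _; move: Jle.
  rewrite -(fineK J_fin) -EFinM !lee_fin => Jle.
  have := ler_wpM2r (fine_ge0 J0) eD; lra.
by move=> _ _; rewrite gt0_muley ?leey// lte_fin mulr_gt0// lt0r kn0.
Qed.

End truncated.

(** Both truncations are released together: at each point the sum, [wn 0] and [sn 0] are below [j]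
    for all large [j]. *)
Lemma sparse_bound :
  \int[mu]_t ((\sum_(n < N.+1) \1_(S n) t * x n t) `^ p * w t)%:E <=
  (2 * (K `^ p * e `^ (1 - p) * doob_cst p))%:E *
  \int[mu]_t (X t `^ p * w t)%:E.
Proof.
pose B (b : R) := [set t | wn 0%N t <= b]%R `&` [set t | sn 0%N t <= b]%R.
have mB b : measurable (B b) by exact: Fm (trunc_set_wrt b).
pose f j t := (\1_(B j%:R) t * (cap j%:R t `^ p * w t))%R.
have w0' t : (0 <= w t)%R by exact: ltW.
have mf j : measurable_fun [set: T] (f j).
  apply: measurable_funM; first exact: measurable_indic.
  exact: measurable_funM.
apply: (@ge0_integral_limit_le _ _ _ _ _ measurableT _ f) => //.
- by move=> j t _; rewrite mulr_ge0// mulr_ge0 ?powR_ge0.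
- move=> t _ i j ij; apply: ler_pM => //.
  + by rewrite mulr_ge0 ?powR_ge0.
  + rewrite !indicE; case: (boolP (t \in B i%:R)) => [/set_mem[w1 s1]|_]; last by case: (_ \in _).
    by rewrite mem_set//; split => /=; [apply: le_trans w1 _|apply: le_trans s1 _]; rewrite ler_nat.
  + rewrite ler_wpM2r//; apply: ge0_le_powR; rewrite ?cap0 ?(ltW p0)//.
    by rewrite le_min !ge_min lexx/= ler_nat ij orbT.
- move=> t _; near=> j; rewrite /f /cap indicE mem_set; last first.
    by split => /=; near: j; exact: nbhs_infty_ger.
  rewrite mul1r (min_idPl _)//; near: j; exact: nbhs_infty_ger.
- move=> j; under eq_integral do rewrite /f EFinM.
  by rewrite ge0_integral_indic_mul truncated_bound.
Unshelve. all: by end_near. Qed.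

End sparse_bound.

(** * The starts of the stages form a sparse family *)

Section stage_sum_bound.
Context d (T : measurableType d) (R : realType) (mu : probability T R).
Context (F : nat -> set (set T)) (hF : filtration F).
Context (p : R) (p1 : (1 < p)%R).
Context (w : T -> R) (mw : measurable_fun [set: T] w) (w0 : forall t, (0 < w t)%R).
Context (wn sn : nat -> T -> R).
Context (wn0 : forall n t, (0 < wn n t)%R) (sn0 : forall n t, (0 < sn n t)%R).
Context (mwn : forall n, measurable_wrt (F n) (wn n)).
Context (msn : forall n, measurable_wrt (F n) (sn n)).
Hypothesis wnE : forall n A, F n A ->
  \int[mu]_(t in A) (wn n t)%:E = \int[mu]_(t in A) (w t)%:E.
Hypothesis snE : forall n A, F n A ->
  \int[mu]_(t in A) (sn n t)%:E =
  \int[mu]_(t in A) (w t `^ (- (p - 1)^-1)%R)%:E.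
Context (Q : R) (Q0 : (0 < Q)%R).
Hypothesis wsQ : forall n t, (wn n t * sn n t `^ (p - 1) <= Q)%R.
Context (X : T -> R) (mX : measurable_fun [set: T] X) (X0 : forall t, (0 <= X t)%R).
Context (x : nat -> T -> R) (x0 : forall n t, (0 <= x n t)%R).
Context (mx : forall n, measurable_wrt (F n) (x n)).
Hypothesis xE : forall n A, F n A ->
  \int[mu]_(t in A) (x n t)%:E = \int[mu]_(t in A) (X t)%:E.
Context (r : R) (r2 : (2 < r)%R) (m0 : nat) (m0_gt0 : (0 < m0)%N).

Definition sparse_cst (q : R) : R :=
  (2 * ((4 * 8 `^ (q + (q - 1)^-1)) `^ q *
    (2 * (doob_cst (q / (q - 1)) + 1))^-1 `^ (1 - q) * doob_cst q))%R.

Lemma sparse_cst_ge0 q : (0 <= sparse_cst q)%R.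
Proof. by rewrite /sparse_cst !mulr_ge0 ?powR_ge0 ?doob_cst_ge0. Qed.

Lemma stage_sum_bound N :
  \int[mu]_t (stage_sum r m0 (x^~ t) N `^ p * w t)%:E <=
  (sparse_cst p * Q `^ (Num.max 1 (p - 1)^-1 * p))%:E *
  \int[mu]_t (X t `^ p * w t)%:E.
Proof.
have sF n : sigma_algebra [set: T] (F n) by case: hF.
have Fm n : F n `<=` measurable by case: hF.
have FS n : F n `<=` F n.+1 by case: hF => _ _; apply.
pose fr n := [set t | fresh (state r m0 (x^~ t) n)].
(* Starts at the value 0 add nothing to [stage_sum] and are left out, as the Lyapunov argument needs
   a positive height. [E n] removes the restarts at times n + 1 to N only, which suffices for
   disjointness up to the horizon. *)
pose S n := fr n `&` [set t | 0 < x n t]%R.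
pose E n := S n `\` \bigcup_(j < N - n) fr (n + j.+1)%N.
have Ffr n : F n (fr n) by exact: (measurable_wrt_fresh hF).
have FSn n : F n (S n).
  apply: (setI_wrt hF) => //.
  rewrite (_ : [set t | _] = x n @^-1` `]0%R, +oo[%classic); last first.
    by apply/seteqP; split => t /=; rewrite in_itv/= andbT.
  exact: (measurable_wrt_preimage (sF n) (@mx n)).
have mE n : measurable (E n).
  apply: measurableD; first exact: Fm (FSn n).
  by apply: bigcup_measurable => j _; exact: Fm (Ffr _).
have Edisj i j t : (i <= N)%N -> (j <= N)%N -> E i t -> E j t -> i = j.
  wlog ij : i j / (i < j)%N.
    move=> H iN jN Ei Ej; have [lt|lt|//] := ltngtP i j; first exact: H.
    by apply/esym; exact: H.
  move=> iN jN [_ nE] [[frj _] _]; exfalso; apply: nE.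
  exists (j - i.+1)%N => /=; first by rewrite subnSK// leq_sub2r.
  by rewrite addnS -addSn subnKC.
have xS n A : F n A -> \int[mu]_(t in A) (x n.+1 t)%:E = \int[mu]_(t in A) (x n t)%:E.
  by move=> FA; rewrite !xE//; exact: FS.
have half n A : (n <= N)%N -> F n A -> A `<=` S n -> mu A <= 2%:E * mu (A `&` E n).
  move=> nN FA AS; have mA := Fm _ _ FA.
  have A_fresh : A `<=` [set t | fresh (state r m0 (x^~ t) n) /\ (0 < x n t)%R].
    by move=> t /AS[].
  have := stage_end_half hF r2 m0_gt0 x0 mx xS FA A_fresh (N - n).
  set D := A `\` \bigcup_(j < N - n) _.
  have -> : A `&` E n = D.
    rewrite /E setIDA; congr (_ `\` _); exact/setIidl.
  have mD : measurable D.
    apply: measurableD => //; apply: bigcup_measurable => j _; exact: Fm (Ffr _).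
  have DA : D `<=` A by exact: subDsetl.
  have AE : mu A = mu D + mu (A `\` D).
    rewrite -[in LHS](setDUK DA) measureU//; first exact: measurableD.
    by rewrite setDE setICA setICr setI0.
  have fA := fin_num_measure mu A mA; have fD := fin_num_measure mu D mD.
  have fAD := fin_num_measure mu _ (measurableD mA mD).
  move: AE; rewrite -(fineK fA) -(fineK fD) -(fineK fAD) -!EFinM -EFinD.
  by move=> [] AE; rewrite !lee_fin; lra.
have := sparse_bound hF p1 mw w0 wn0 sn0 mwn msn wnE snE Q0 wsQ mX X0 x0 mx xE
  FSn mE Edisj half.
have sumE t : (\sum_(n < N.+1) \1_(S n) t * x n t)%R = stage_sum r m0 (x^~ t) N.
  apply: eq_bigr => n _; rewrite indicE.
  have [/set_mem[/= -> _]|/negP nS] := boolP (t \in S n); first by rewrite mul1r.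
  rewrite mul0r; case: ifP => // frn.
  apply/eqP; rewrite eq_le x0 andTb leNgt; apply/negP => xpos.
  by apply: nS; apply/mem_set; split.
under eq_integral do rewrite sumE.
have -> : ((4 * (8 `^ (p + (p - 1)^-1) * Q `^ Num.max 1 (p - 1)^-1)) `^ p =
    (4 * 8 `^ (p + (p - 1)^-1)) `^ p * Q `^ (Num.max 1 (p - 1)^-1 * p))%R.
  by rewrite mulrA powRM ?mulr_ge0 ?powR_ge0// -powRrM.
move/le_trans; apply; rewrite le_eqVlt; apply/orP; left; apply/eqP.
by congr (_%:E * _); rewrite /sparse_cst; ring.
Qed.

End stage_sum_bound.

(** * The A_p characteristic at deterministic times *)

Section Ap_versions.
Context d (T : measurableType d) (R : realType) (mu : probability T R).
Context (F : nat -> set (set T)) (hF : filtration F).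
Context (p : R) (p1 : (1 < p)%R).
Context (w : T -> R) (hw : is_weight F w).

Let sF n : sigma_algebra [set: T] (F n). Proof. by case: hF. Qed.
Let Fm n : F n `<=` measurable. Proof. by case: hF. Qed.

Lemma filtration_infty_measurable : filtration_infty F `<=` measurable.
Proof.
apply: smallest_sub => [|A [n _ FA]]; last exact: Fm FA.
by split => [|A mA|A mA]; [exact: measurable0|exact: measurableD|exact: bigcup_measurable].
Qed.

Lemma measurable_filtration_infty (f : T -> R) :
  measurable_wrt (filtration_infty F) f -> measurable_fun [set: T] f.
Proof.
apply: measurable_wrt_fun; last exact: filtration_infty_measurable.
exact: smallest_sigma_algebra.
Qed.

Lemma stopped_cst n : stopped_sigma_algebra F (fun=> Some n) = F n.
Proof.
have leE k : time_le (fun=> Some n) k = [set t : T | (n <= k)%N].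
  by apply/seteqP; split => t /=; [case=> _ [<-]|exists n].
have F0 k : F k set0.
  by rewrite -(measurable_subalgE (sF k)); exact: measurable0.
apply/seteqP; split => A.
  by move=> [_ /(_ n)]; rewrite leE leqnn (_ : [set _ | _] = setT) ?setIT//; apply/seteqP.
move=> FA; split; first by apply: sub_sigma_algebra; exists n.
move=> k; rewrite leE; have [nk|nk] := leqP n k.
  rewrite (_ : [set _ | _] = setT) ?setIT; last exact/seteqP.
  by case: hF => _ _; apply; [exact: nk|].
by rewrite (_ : [set _ | _] = set0) ?setI0//; apply/seteqP; split => t.
Qed.

Lemma stopping_time_cst n : stopping_time F (fun=> Some n).
Proof.
move=> k; have [nk|nk] := leqP n k.
  rewrite (_ : time_le _ _ = setT); last by apply/seteqP; split => t // _; exists n.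
  by rewrite -(measurable_subalgE (sF k)); exact: measurableT.
rewrite (_ : time_le _ _ = set0); last first.
  by apply/seteqP; split => t // [_ [<-]]; rewrite leqNgt nk.
by rewrite -(measurable_subalgE (sF k)); exact: measurable0.
Qed.

Let w0 t : (0 < w t)%R. Proof. by case: hw. Qed.
Let mw : measurable_fun [set: T] w.
Proof. by case: hw => mw _; exact: measurable_filtration_infty. Qed.

Lemma weighted_null A : measurable A -> \int[mu]_(t in A) (w t)%:E = 0 -> mu A = 0.
Proof.
move=> mA A0.
have mwA : measurable_fun A (EFin \o w) by exact: measurable_fun_EFin.
have : ae_eq mu A (EFin \o w) (cst 0).
  apply/(ae_eq_integral_abs mu mA mwA).
  rewrite -[RHS]A0; apply: eq_integral => t _.
  by rewrite gee0_abs//= lee_fin ltW.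
move=> [N [mN N0 sN]]; apply/eqP; rewrite -measure_le0 -N0.
apply: le_measure; rewrite ?inE// => t At; apply: sN => /= /(_ At) [] /eqP.
by rewrite gt_eqF.
Qed.

Lemma condexp_ge0_neq0 (f : T -> R) n u : (forall t, (0 < f t)%R) ->
  measurable_fun [set: T] f -> is_condexp_ge0 mu (F n) f u ->
  mu [set t | u t = 0] = 0.
Proof.
move=> f0 mf [mu_ u0 uE]; set Z := [set t | _].
have FZ : F n Z.
  rewrite (_ : Z = u @^-1` [set 0])//.
  exact: (measurable_wrt_preimage (sF n) mu_).
have : \int[mu]_(t in Z) (f t)%:E = 0.
  by rewrite -uE// integral0_eq.
move=> Z0; have mfZ : measurable_fun Z (EFin \o f) by exact: measurable_fun_EFin.
have mZ := Fm FZ.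
have : ae_eq mu Z (EFin \o f) (cst 0).
  apply/(ae_eq_integral_abs mu mZ mfZ).
  rewrite -[RHS]Z0; apply: eq_integral => t _.
  by rewrite gee0_abs//= lee_fin ltW.
move=> [N [mN N0 sN]]; apply/eqP; rewrite -measure_le0 -N0.
apply: le_measure; rewrite ?inE// => t At; apply: sN => /= /(_ At) [] /eqP.
by rewrite gt_eqF.
Qed.

Let sg t := (w t `^ (- (p - 1)^-1))%R.
Let sg0 t : (0 < sg t)%R. Proof. exact: powR_gt0. Qed.
Let msg : measurable_fun [set: T] sg.
Proof. exact: (measurableT_comp (measurable_powR _)). Qed.

(** Positive real versions satisfying the A_p bound at every point, so that later pointwise
    estimates have no exceptional sets. Where the given versions misbehave they are replaced by y
    and 1, whose A_p product is y. *)
Lemma Ap_versions (y : R) n : (0 < y)%R -> Ap_characteristic mu F p w < y%:E ->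
  exists wn sn : T -> R, [/\ (forall t, (0 < wn t)%R) /\ (forall t, (0 < sn t)%R),
    measurable_wrt (F n) wn /\ measurable_wrt (F n) sn,
    forall A, F n A -> \int[mu]_(t in A) (wn t)%:E = \int[mu]_(t in A) (w t)%:E,
    forall A, F n A -> \int[mu]_(t in A) (sn t)%:E = \int[mu]_(t in A) (sg t)%:E &
    forall t, (wn t * sn t `^ (p - 1) <= y)%R].
Proof.
move=> y0 Apy.
have [u uP] := condexp_ge0_ex mu (sF n) (@Fm n) mw (fun t => ltW (w0 t)).
have [v vP] := condexp_ge0_ex mu (sF n) (@Fm n) msg (fun t => ltW (sg0 t)).
have Ly : weighted_Linfty_norm mu w (fun t => u t * v t `^ (p - 1)) < y%:E.
  apply: le_lt_trans Apy; apply: ereal_sup_ubound.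
  exists (fun=> Some n), u, v; split => //; rewrite ?stopped_cst//.
  exact: stopping_time_cst.
(* The strict hypothesis yields an almost everywhere bound y' below [y]. *)
have [y' [N [mN N0 sN]] y'y] := ereal_inf_lt Ly.
have muN := weighted_null mN N0.
have u0N := condexp_ge0_neq0 w0 mw uP; have v0N := condexp_ge0_neq0 sg0 msg vP.
case: uP => mu_ u0 uE; case: vP => mv v0 vE.
have pm0 : (0 < p - 1)%R by rewrite subr_gt0.
(* A condition on the values of [u] and [v], hence measurable at time [n], which the null set [N]
   need not be. As [fine] sends +oo to 0, its positivity also excludes infinite values. *)
pose good t := [&& 0 < fine (u t), 0 < fine (v t) & fine (u t) * fine (v t) `^ (p - 1) <= y]%R.
pose wn t := if good t then fine (u t) else y.
pose sn t := if good t then fine (v t) else 1%R.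
have mfu : measurable_wrt (F n) (fine \o u) by apply: measurableT_comp mu_ => //; exact: fine_measurable.
have mfv : measurable_wrt (F n) (fine \o v) by apply: measurableT_comp mv => //; exact: fine_measurable.
have mgood : measurable_wrt (F n) good.
  apply: measurable_and; first exact: measurable_fun_ltr.
  apply: measurable_and; first exact: measurable_fun_ltr.
  apply: measurable_fun_ler => //; apply: measurable_funM => //.
  exact: (measurableT_comp (measurable_powR _) mfv).
have mwn : measurable_wrt (F n) wn by exact: measurable_fun_ifT.
have msn : measurable_wrt (F n) sn by exact: measurable_fun_ifT.
pose bad := N `|` ([set t | u t = 0] `|` [set t | v t = 0]).
have mset0 (f : T -> \bar R) : measurable_wrt (F n) f -> measurable [set t | f t = 0].
  move=> mf; apply: Fm; exact: (measurable_wrt_preimage (B := [set 0]) (sF n) mf).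
have mbad : measurable bad by apply: measurableU => //; apply: measurableU; exact: mset0.
have bad0 : mu bad = 0.
  have nullU (A B : set T) : measurable A -> measurable B -> mu A = 0 -> mu B = 0 ->
      mu (A `|` B) = 0.
    move=> mA mB A0 B0; apply/eqP; rewrite -measure_le0.
    have U2 : mu (A `|` B) <= mu A + mu B by exact: measureU2.
    by apply: (le_trans U2); rewrite A0 B0 adde0.
  have mu0 := mset0 _ mu_; have mv0 := mset0 _ mv.
  have uv0 := nullU _ _ mu0 mv0 u0N v0N.
  exact: nullU mN (measurableU _ _ mu0 mv0) muN uv0.
have goodP t : ~ bad t -> good t.
  move=> /not_orP[nN /not_orP[/= un0 vn0]].
  have ugt0 : 0 < u t by rewrite lt0e u0 andbT; exact/eqP.
  have vgt0 : 0 < v t by rewrite lt0e v0 andbT; exact/eqP.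
  have le_y' : u t * v t `^ (p - 1) <= y'.
    apply: contrapT => nle; apply: nN; apply: sN => /= H; apply: nle.
    by apply: le_trans H; rewrite gee0_abs// mule_ge0 ?poweR_ge0.
  have lt_y := le_lt_trans le_y' y'y; rewrite /good.
  move: ugt0 vgt0 lt_y {un0 vn0 le_y'}.
  case: (u t) => [a| |//]; case: (v t) => [b| |//].
  - by rewrite poweR_EFin -EFinM !lte_fin /= => -> -> /ltW ->.
  - move=> a0 _; rewrite poweRyr ?gt_eqF// gt0_muley//.
  - move=> _ b0; rewrite gt0_mulye ?poweR_gt0//.
  - move=> _ _; rewrite poweRyr ?gt_eqF// gt0_muley//.
have ae_int (f : T -> R) g : measurable_wrt (F n) f -> measurable_wrt (F n) g ->
    (forall t, 0 <= f t)%R -> (forall t, 0 <= g t) ->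
    (forall t, good t -> (f t)%:E = g t) ->
    forall A, F n A -> \int[mu]_(t in A) (f t)%:E = \int[mu]_(t in A) g t.
  move=> mf mg f0 g0 fg A FA; have mA := Fm FA.
  apply: ge0_ae_eq_integral => //.
  - exact: measurable_fun_EFin (measurable_wrt_fun (sF n) (@Fm n) mf).
  - by apply: measurable_funTS; exact: (measurable_wrt_fun (sF n) (@Fm n) mg).
  - by move=> t _; rewrite lee_fin.
  - exists bad; split => // t nfg; apply: contrapT => nbad; apply: nfg => _.
    by apply: fg; exact: goodP.
have fin_good (g : \bar R) : 0 <= g -> (0 < fine g)%R -> (fine g)%:E = g.
  by case: g => //= _; rewrite ltxx.
have wn0 t : (0 < wn t)%R by rewrite /wn; case: ifP => // /and3P[].
have sn0 t : (0 < sn t)%R by rewrite /sn; case: ifP => // /and3P[].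
exists wn, sn; split => //.
- move=> A FA; rewrite -uE//; apply: ae_int => //; first by move=> t; exact: ltW.
  by move=> t gt; rewrite /wn gt; case/and3P: gt => ? _ _; exact: fin_good.
- move=> A FA; rewrite -vE//; apply: ae_int => //; first by move=> t; exact: ltW.
  by move=> t gt; rewrite /sn gt; case/and3P: gt => _ ? _; exact: fin_good.
- move=> t; rewrite /wn /sn; case: ifP => [/and3P[]//|_].
  by rewrite powR1 mulr1.
Qed.

(** Since w sg^(p-1) = 1, and w <= 8 wn and sg <= 8 sn hold off two sets of measure at most 1/8, the
    product wn sn^(p-1) is at least 8^-p somewhere; [y] is half of that value. Positivity is what
    makes 2 q a strict upper bound in [two_sided_bound]. *)
Lemma Ap_gt0 : 0 < Ap_characteristic mu F p w.
Proof.
rewrite ltNge; apply/negP => Ap0.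
have p0 : (0 < p)%R by exact: lt_trans p1.
pose y : R := ((8 `^ p)^-1 / 2)%R.
have y0 : (0 < y)%R by rewrite divr_gt0 ?invr_gt0 ?powR_gt0.
have [|wn [sn [[wn0 sn0] [mwn msn] wnE snE wsy]]] := @Ap_versions y 0%N y0.
  by apply: le_lt_trans Ap0 _; rewrite lte_fin.
have FT : F 0%N setT by rewrite -(measurable_subalgE (sF 0%N)); exact: measurableT.
have m1 := conditional_markov (sF 0%N) (@Fm 0%N) msg sg0 msn sn0 snE FT.
have m2 := conditional_markov (sF 0%N) (@Fm 0%N) mw w0 mwn wn0 wnE FT.
set B1 := _ `&` _ in m1; set B2 := _ `&` _ in m2.
have cover : setT `<=` B1 `|` B2.
  move=> t _; have [s8|s8] := leP (sg t) (8 * sn t)%R; last by left.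
  have [w8|w8] := leP (w t) (8 * wn t)%R; last by right.
  exfalso; have : (w t * sg t `^ (p - 1) <= (8 * wn t) * (8 * sn t) `^ (p - 1))%R.
    apply: ler_pM; rewrite ?powR_ge0 ?(ltW (w0 t))//.
    by apply: ge0_le_powR => //; [rewrite subr_ge0 ltW|exact: ltW].
  rewrite /sg -powRrM mulNr mulVf ?gt_eqF ?subr_gt0//.
  rewrite powR_inv1 ?(ltW (w0 t))// mulfV ?gt_eqF//.
  rewrite powRM ?(ltW (sn0 t))// mulrACA mulr_powRB1// => h1.
  have yE : (8 `^ p * y = 1 / 2)%R by rewrite /y mulrA mulfV ?gt_eqF ?powR_gt0.
  by have := ler_wpM2l (powR_ge0 8 p) (wsy t); rewrite yE; move: h1; lra.
have mset (f c : T -> R) : measurable_fun [set: T] f -> measurable_fun [set: T] c ->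
    measurable (setT `&` [set t | 8 * c t < f t]%R).
  move=> mf mc; rewrite setTI.
  rewrite (_ : [set t | _] = (fun t => 8 * c t < f t)%R @^-1` [set true]); last first.
    by apply/seteqP; split => t /=.
  rewrite -[X in measurable X]setTI; apply: measurable_fun_ltr => //.
  exact: measurable_funM.
have mB1 : measurable B1 by exact: mset msg (measurable_wrt_fun (sF 0%N) (@Fm 0%N) msn).
have mB2 : measurable B2 by exact: mset mw (measurable_wrt_fun (sF 0%N) (@Fm 0%N) mwn).
have : (mu setT <= mu B1 + mu B2)%E.
  apply: (@le_trans _ _ (mu (B1 `|` B2))); last exact: measureU2.
  by apply: le_measure; rewrite ?inE//; exact: measurableU.
move: m1 m2; rewrite probability_setT mule1.
rewrite -(fineK (fin_num_measure mu _ mB1)) -(fineK (fin_num_measure mu _ mB2)).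
by rewrite -EFinD !lee_fin; lra.
Qed.

End Ap_versions.

(** * Splitting a martingale into two nonnegative ones *)

Section martingale_decomposition.
Context d (T : measurableType d) (R : realType) (mu : probability T R).
Context (G : set (set T)) (sG : sigma_algebra [set: T] G) (Gm : G `<=` measurable).

Lemma ge0_integrable_EFin (f : T -> R) : measurable_fun [set: T] f ->
  (forall t, (0 <= f t)%R) -> \int[mu]_t (f t)%:E < +oo ->
  mu.-integrable [set: T] (EFin \o f).
Proof.
move=> mf f0 foo; apply/integrableP; split; first exact/measurable_EFinP.
rewrite (eq_integral (fun t => (f t)%:E))// => t _.
by rewrite gee0_abs//= lee_fin.
Qed.

(** The path argument wants nonnegativity at every point, not only almost everywhere. A version y'
    of the average of the positive part is therefore raised to max(y', M). Its integrals do not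
    change: over the set where y' < M, the integral of M - y' equals that of X minus its positive
    part, which is at most 0. *)
Lemma condexp_decomposition (X M : T -> R) : measurable_fun [set: T] X ->
  mu.-integrable [set: T] (EFin \o X) -> is_condexp mu G X M ->
  exists y : T -> R, [/\ measurable_wrt G y, forall t, (0 <= y t)%R,
    forall t, (M t <= y t)%R,
    forall A, G A -> \int[mu]_(t in A) (y t)%:E =
      \int[mu]_(t in A) (Num.max (X t) 0)%:E &
    forall A, G A -> \int[mu]_(t in A) (y t - M t)%:E =
      \int[mu]_(t in A) (Num.max (- X t) 0)%:E].
Proof.
move=> mX iX [mM iM ME].
have mT (f : T -> R) : measurable_wrt G f -> measurable_fun [set: T] f.
  by move=> mf; exact: (measurable_wrt_fun sG Gm mf).
pose Xp t := Num.max (X t) 0%R; pose Xm t := Num.max (- X t)%R 0%R.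
have mXp : measurable_fun [set: T] Xp by exact: measurable_maxr.
have Xp0 t : (0 <= Xp t)%R by rewrite le_max lexx orbT.
have iXp : mu.-integrable [set: T] (EFin \o Xp).
  apply: le_integrable iX => //; first exact/measurable_EFinP.
  by move=> t _ /=; rewrite lee_fin ger0_norm// ge_max ler_norm normr_ge0.
have [y' [my' y'0 y'E]] := condexp_integrable_ex sG Gm iXp Xp0.
have GT : G setT by rewrite -(measurable_subalgE sG); exact: measurableT.
have iy' : mu.-integrable [set: T] (EFin \o y').
  apply: ge0_integrable_EFin => //; first exact: mT.
  by rewrite y'E//; have := integrable_lty measurableT iXp; rewrite ltey_eq; case: integral.
pose d' t := Num.max (M t - y' t)%R 0%R.
pose A := [set t | y' t < M t]%R.
have GA : G A.
  rewrite -(measurable_subalgE sG).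
  rewrite (_ : A = (fun t => y' t < M t)%R @^-1` [set true]); last first.
    by apply/seteqP; split => t /=.
  by rewrite -[X in measurable X]setTI; exact: measurable_fun_ltr.
have iS (f : T -> R) C : G C -> mu.-integrable [set: T] (EFin \o f) ->
    mu.-integrable C (EFin \o f).
  by move=> GC; apply: integrableS => //; exact: Gm.
have d0 t : (0 <= d' t)%R by rewrite le_max lexx orbT.
have md : measurable_wrt G d'.
  by apply: measurable_maxr => //; exact: measurable_funB.
have intd : \int[mu]_t (d' t)%:E <= 0.
  have -> : \int[mu]_t (d' t)%:E = \int[mu]_(t in A) ((M t)%:E - (y' t)%:E).
    rewrite [RHS]integral_mkcond; apply: eq_integral => t _; rewrite patchE /d'.
    case: (boolP (t \in A)) => [/set_mem/= tA|/negP tA].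
      by rewrite -EFinB (max_idPl _)// subr_ge0 ltW.
    rewrite (max_idPr _)// subr_le0 leNgt; apply/negP => lt; apply: tA.
    exact/mem_set.
  rewrite integralB_EFin//; [|exact: Gm|exact: iS|exact: iS].
  rewrite ME// y'E// -integralB_EFin//; [|exact: Gm|exact: iS|exact: iS].
  rewrite (_ : 0 = \int[mu]_(t in A) 0); last by rewrite integral0.
  apply: le_integral; [exact: Gm| |exact: integrable0|].
    apply: integrableB; [exact: Gm|exact: iS|exact: iS].
  by move=> t _; rewrite -EFinB lee_fin subr_le0 le_max lexx.
have intd0 C : G C -> \int[mu]_(t in C) (d' t)%:E = 0.
  move=> GC; apply/eqP; rewrite eq_le integral_ge0 ?andbT; last first.
    by move=> t _; rewrite lee_fin.
  apply: le_trans intd; apply: ge0_subset_integral => //; first exact: Gm.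
    by apply/measurable_EFinP; exact: mT.
  by move=> t _; rewrite lee_fin.
pose y t := (y' t + d' t)%R.
have my : measurable_wrt G y by exact: measurable_funD.
have y0 t : (0 <= y t)%R by rewrite addr_ge0.
have yE C : G C -> \int[mu]_(t in C) (y t)%:E = \int[mu]_(t in C) (Xp t)%:E.
  move=> GC; rewrite ge0_integralD_EFin//; [|exact: Gm|exact: mT|exact: mT].
  by rewrite intd0// adde0 y'E.
have iy : mu.-integrable [set: T] (EFin \o y).
  apply: ge0_integrable_EFin => //; first exact: mT.
  by rewrite yE//; have := integrable_lty measurableT iXp; rewrite ltey_eq; case: integral.
exists y; split => //.
  by move=> t; rewrite /y /d' addr_maxr subrKC le_max lexx.
move=> C GC; under eq_integral do rewrite EFinB.
rewrite integralB_EFin//; [|exact: Gm|exact: iS|exact: iS].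
rewrite ME// yE// -integralB_EFin//; [|exact: Gm|exact: iS|exact: iS].
apply: eq_integral => t _; rewrite -EFinB; congr EFin; rewrite /Xp.
by rewrite addr_maxl subrr sub0r maxC.
Qed.

End martingale_decomposition.

(** * From finite horizons to the full variation *)

Section variation_fatou.
Context d (T : measurableType d) (R : realType) (mu : probability T R).
Context (F : nat -> set (set T)) (hF : filtration F).
Context (p r : R) (p0 : (0 < p)%R) (r2 : (2 < r)%R).
Context (w : T -> R) (mw : measurable_fun [set: T] w) (w0 : forall t, (0 < w t)%R).
Context (y z : nat -> T -> R).
Context (y0 : forall n t, (0 <= y n t)%R) (z0 : forall n t, (0 <= z n t)%R).
Context (my : forall n, measurable_wrt (F n) (y n)).
Context (mz : forall n, measurable_wrt (F n) (z n)).
Context (M : nat -> T -> R) (ME : forall n t, M n t = (y n t - z n t)%R).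

(** The integral of a nonnegative function is a supremum over simple minorants, hence monotone
    without measurability. This matters for the variation, a supremum over uncountably many
    sequences. *)
Lemma ge0_integral_mono (f g : T -> \bar R) :
  (forall t, 0 <= f t) -> (forall t, f t <= g t) ->
  \int[mu]_t f t <= \int[mu]_t g t.
Proof.
move=> f0 fg; have g0 t : 0 <= g t := le_trans (f0 t) (fg t).
rewrite !ge0_integralTE//; apply: ereal_sup_le => _ [h /= hf <-].
by exists h => //= t; exact: le_trans (hf t) (fg t).
Qed.

Lemma powR_add_le (a b e : R) : (0 <= e)%R -> (0 <= a)%R -> (0 <= b)%R ->
  ((a + b) `^ e <= 2 `^ e * (a `^ e + b `^ e))%R.
Proof.
move=> e0 a0 b0; wlog ab : a b a0 b0 / (a <= b)%R.
  move=> H; have [|/ltW] := leP a b; first exact: H.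
  by rewrite addrC [(a `^ e + _)%R]addrC; exact: H.
apply: (@le_trans _ _ ((2 * b) `^ e)%R).
  by apply: ge0_le_powR; rewrite ?addr_ge0//; lra.
by rewrite powRM// ler_wpM2l ?powR_ge0// lerDr powR_ge0.
Qed.

Definition two_sided_sum N t : R :=
  (stage_sum r N.+1 (y^~ t) N + stage_sum r N.+1 (z^~ t) N)%R.

Let a : R := (64 * Num.sqrt (r / (r - 2)))%R.

Let a0 : (0 <= a)%R. Proof. by rewrite mulr_ge0. Qed.

Lemma stage_sum_ge0 (x : nat -> R) m0 N : (forall n, 0 <= x n)%R ->
  (0 <= stage_sum r m0 x N)%R.
Proof. by move=> x0; apply: sumr_ge0 => k _; case: ifP. Qed.

Lemma measurable_stage_sum (x : nat -> T -> R) m0 N :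
  (forall n, measurable_wrt (F n) (x n)) ->
  measurable_fun [set: T] (fun t => stage_sum r m0 (x^~ t) N).
Proof.
move=> mx; apply: measurable_sum => k.
have [_ Fm _] := hF; have [sF _ _] := hF.
apply: measurable_fun_ifT => //; last exact: (measurable_wrt_fun (sF k) (Fm k) (@mx k)).
have [_ _ _ mf] := measurable_state hF r m0 mx k.
exact: (measurable_wrt_fun (sF k) (Fm k) mf).
Qed.

Lemma two_sided_ge0 N t : (0 <= two_sided_sum N t)%R.
Proof. by rewrite addr_ge0// stage_sum_ge0. Qed.

Lemma measurable_two_sided N : measurable_fun [set: T] (two_sided_sum N).
Proof. by apply: measurable_funD; exact: measurable_stage_sum. Qed.

Lemma variation_le_two_sided t N J (u : nat -> nat) :
  {homo u : i j / (i < j)%N} -> (u J <= N)%N ->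
  (\sum_(j < J) `|M (u j) t - M (u j.+1) t| `^ r <= (a * two_sided_sum N t) `^ r)%R.
Proof.
move=> uinc uJ; have r0 : (0 <= r)%R by rewrite ltW// (lt_trans _ r2).
have r1 : (1 <= r)%R by rewrite ltW// (lt_trans _ r2)// ltr1n.
apply: (@le_trans _ _ (2 `^ r * (\sum_(j < J) `|y (u j) t - y (u j.+1) t| `^ r +
    \sum_(j < J) `|z (u j) t - z (u j.+1) t| `^ r))%R).
  rewrite -big_split mulr_sumr; apply: ler_sum => j _.
  apply: le_trans (powR_add_le r0 (normr_ge0 _) (normr_ge0 _)).
  apply: ge0_le_powR => //; rewrite !ME.
  rewrite (_ : _ - _ - _ = (y (u j) t - y (u j.+1) t) - (z (u j) t - z (u j.+1) t))%R.
    exact: ler_normB.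
  by ring.
have hy := variation_le_stage_sum r2 (y0^~ t) uinc uJ (ltnSn N).
have hz := variation_le_stage_sum r2 (z0^~ t) uinc uJ (ltnSn N).
apply: le_trans (ler_wpM2l (powR_ge0 2 r) (lerD hy hz)) _.
rewrite (_ : a * _ = 2 * (32 * Num.sqrt (r / (r - 2)) * stage_sum r N.+1 (y^~ t) N +
   32 * Num.sqrt (r / (r - 2)) * stage_sum r N.+1 (z^~ t) N))%R; last first.
  by rewrite /a /two_sided_sum; ring.
rewrite [leRHS]powRM// ?addr_ge0 ?mulr_ge0 ?stage_sum_ge0// ler_wpM2l ?powR_ge0//.
by apply: powR_superadd; rewrite ?mulr_ge0 ?stage_sum_ge0.
Qed.

Lemma variation_seq_ge0 t : 0 <= variation_seq r M t.
Proof.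
apply: le_trans (poweR_ge0 _ r^-1%R) _; apply: ereal_sup_ubound.
by exists id.
Qed.

(** A finite part of a sequence, up to [u J], is controlled by the two-sided sum for every N >= u J,
    hence by the lower limit. If the latter is a finite [l], the variation is at most (l /
    w)^(1/p). *)
Lemma variation_le_liminf t :
  `|variation_seq r M t| `^ p * (w t)%:E <=
  limn_einf (fun N => ((a * two_sided_sum N t) `^ p * w t)%:E).
Proof.
set L := limn_einf _.
have Lge (c : R) n : (forall N, (n <= N)%N ->
    (c <= (a * two_sided_sum N t) `^ p * w t)%R) -> c%:E <= L.
  move=> H; rewrite /L limn_einf_lim; apply: lime_ge; first exact: is_cvg_einfs.
  near=> m; apply: le_ereal_inf_tmp => _ [N /= mN <-]; rewrite lee_fin; apply: H.
  by apply: leq_trans mN; near: m; exact: nbhs_infty_ge.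
have L0 : 0 <= L.
  by apply: (Lge 0%R 0%N) => N _; rewrite mulr_ge0 ?powR_ge0 ?ltW.
case: L L0 Lge => [l l0 Lge|_ _|//]; last exact: leey.
have l0' : (0 <= l)%R by rewrite -lee_fin.
have r0 : (0 < r)%R by rewrite (lt_trans _ r2).
have wt0 := w0 t.
pose c := ((l / w t) `^ p^-1)%R.
have c0 : (0 <= c)%R by exact: powR_ge0.
have Vc : variation_seq r M t <= c%:E.
  apply: ge_ereal_sup => _ [u uinc ->].
  have : \sum_(0 <= j <oo) (`|M (u j) t - M (u j.+1) t| `^ r)%:E <= (c `^ r)%:E.
    apply: lime_le; first by apply: is_cvg_nneseries => j _ _; rewrite lee_fin powR_ge0.
    apply: nearW => J; rewrite sumEFin lee_fin big_mkord.
    set s := (\sum_(j < J) _)%R.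
    have s0 : (0 <= s)%R by apply: sumr_ge0 => j _; exact: powR_ge0.
    have : ((s `^ r^-1) `^ p * w t <= l)%R.
      rewrite -lee_fin; apply: (Lge _ (u J)) => N uN.
      rewrite ler_wpM2r ?(ltW wt0)//; apply: ge0_le_powR; [exact: ltW|exact: powR_ge0|].
      rewrite -[leRHS](@powRr1 _ (a * two_sided_sum N t)) ?mulr_ge0 ?two_sided_ge0//.
      rewrite -[in leRHS](mulfV (lt0r_neq0 r0)) powRrM; apply: ge0_le_powR => //.
        by rewrite invr_ge0 ltW.
      exact: variation_le_two_sided.
    rewrite -ler_pdivlMr// => h.
    rewrite -(powRr1 s0) -[in leLHS](mulVf (lt0r_neq0 r0)) powRrM.
    apply: ge0_le_powR; [exact: ltW|exact: powR_ge0|].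
    rewrite -[leLHS](powRr1 (powR_ge0 s r^-1)) -[in leLHS](mulfV (lt0r_neq0 p0)).
    rewrite powRrM; apply: ge0_le_powR => //; first by rewrite invr_ge0 ltW.
    exact: powR_ge0.
  move=> h; have ir0 : (0 <= r^-1)%R by rewrite invr_ge0 ltW.
  apply: (@le_trans _ _ ((c `^ r)%:E `^ r^-1)).
    apply: gt0_ler_poweR => //; rewrite in_itv/= leey ?andbT.
      by apply: nneseries_ge0 => j _ _; rewrite lee_fin powR_ge0.
    by rewrite lee_fin powR_ge0.
  by rewrite poweR_EFin -powRrM mulfV ?gt_eqF// powRr1.
have V0 := variation_seq_ge0 t.
rewrite gee0_abs//; apply: (@le_trans _ _ (c%:E `^ p * (w t)%:E)).
  rewrite lee_wpmul2r ?lee_fin ?(ltW wt0)//; apply: gt0_ler_poweR => //.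
  - exact: ltW.
  - by rewrite in_itv/= leey V0.
  - by rewrite in_itv/= leey lee_fin c0.
rewrite poweR_EFin /c -powRrM mulVf ?gt_eqF// powRr1 ?divr_ge0 ?(ltW wt0)//.
by rewrite -EFinM divfK ?gt_eqF.
Unshelve. all: by end_near. Qed.

Lemma integral_variation_le C :
  (forall N, \int[mu]_t ((a * two_sided_sum N t) `^ p * w t)%:E <= C) ->
  \int[mu]_t (`|variation_seq r M t| `^ p * (w t)%:E) <= C.
Proof.
move=> H; pose f N t := ((a * two_sided_sum N t) `^ p * w t)%:E.
apply: (@le_trans _ _ (\int[mu]_t limn_einf (f^~ t))).
  apply: ge0_integral_mono => t; last exact: variation_le_liminf.
  by rewrite mule_ge0 ?poweR_ge0// lee_fin ltW.
apply: le_trans (fatou mu measurableT _ _) _.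
- move=> N; apply/measurable_EFinP; apply: measurable_funM => //.
  apply: (measurableT_comp (measurable_powR _)); apply: measurable_funM => //.
  exact: measurable_two_sided.
- by move=> N t _; rewrite lee_fin mulr_ge0 ?powR_ge0 ?ltW.
rewrite limn_einf_lim; apply: lime_le; first exact: is_cvg_einfs.
apply: nearW => n; apply: le_trans (H n); apply: ereal_inf_lbound.
by exists n => /=.
Qed.

End variation_fatou.

Lemma ge0_integral_eq0_dominated d (T : measurableType d) (R : realType)
    (mu : {measure set T -> \bar R}) (f g : T -> R) :
  measurable_fun [set: T] f -> measurable_fun [set: T] g ->
  (forall t, (0 <= f t)%R) -> (forall t, (0 <= g t)%R) ->
  (forall t, f t = 0%R -> g t = 0%R) ->
  \int[mu]_t (f t)%:E = 0 -> \int[mu]_t (g t)%:E = 0.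
Proof.
move=> mf mg f0 g0 fg If0.
have mEf : measurable_fun [set: T] (EFin \o f) by exact/measurable_EFinP.
have : ae_eq mu setT (EFin \o f) (cst 0).
  apply/(ae_eq_integral_abs mu measurableT mEf).
  rewrite -[RHS]If0; apply: eq_integral => t _.
  by rewrite gee0_abs//= lee_fin.
move=> aef; rewrite -[RHS](integral0 mu setT); apply: ge0_ae_eq_integral => //.
- exact/measurable_EFinP.
- by move=> t _; rewrite lee_fin.
apply: filterS aef => t /(_ I) /= [] ft0 _ /=.
by rewrite fg.
Qed.

(** * The norm of the two-sided sums *)

Section two_sided_bound.
Context d (T : measurableType d) (R : realType) (mu : probability T R).
Context (F : nat -> set (set T)) (hF : filtration F).
Context (p r : R) (p1 : (1 < p)%R) (r2 : (2 < r)%R).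
Context (w : T -> R) (hw : is_weight F w).
Context (X : T -> R) (mX : measurable_fun [set: T] X).
Context (y z : nat -> T -> R).
Context (y0 : forall n t, (0 <= y n t)%R) (z0 : forall n t, (0 <= z n t)%R).
Context (my : forall n, measurable_wrt (F n) (y n)).
Context (mz : forall n, measurable_wrt (F n) (z n)).
Hypothesis yE : forall n A, F n A ->
  \int[mu]_(t in A) (y n t)%:E = \int[mu]_(t in A) (Num.max (X t) 0)%:E.
Hypothesis zE : forall n A, F n A ->
  \int[mu]_(t in A) (z n t)%:E = \int[mu]_(t in A) (Num.max (- X t) 0)%:E.

Let w0 t : (0 < w t)%R. Proof. by case: hw. Qed.
Let mw : measurable_fun [set: T] w.
Proof. by case: hw => mw _; exact: (measurable_filtration_infty hF). Qed.
Let p0 : (0 < p)%R. Proof. exact: lt_trans p1. Qed.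
Let sF n : sigma_algebra [set: T] (F n). Proof. by case: hF. Qed.
Let Fm n : F n `<=` measurable. Proof. by case: hF. Qed.

Let mXp : measurable_fun [set: T] (fun t => Num.max (X t) 0%R).
Proof. exact: measurable_maxr. Qed.
Let mXm : measurable_fun [set: T] (fun t => Num.max (- X t)%R 0%R).
Proof. by apply: measurable_maxr => //; exact: measurableT_comp. Qed.
Let Xp0 t : (0 <= Num.max (X t) 0)%R. Proof. by rewrite le_max lexx orbT. Qed.
Let Xm0 t : (0 <= Num.max (- X t) 0)%R. Proof. by rewrite le_max lexx orbT. Qed.

Let mpow (f : T -> R) : measurable_fun [set: T] f ->
  measurable_fun [set: T] (fun t => f t `^ p * w t)%R.
Proof.
by move=> mf; apply: measurable_funM => //; exact: (measurableT_comp (measurable_powR _)).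
Qed.

Let pow0 (s : R) t : (0 <= s `^ p * w t)%R.
Proof. by rewrite mulr_ge0 ?powR_ge0 ?ltW. Qed.

(** The positive and negative parts of [X] have disjoint supports, so the two right-hand sides add
    up exactly. The value 2 q stands in for [q] because [Ap_versions] needs a strict upper bound. *)
Lemma two_sided_bound (a q : R) N : (0 <= a)%R ->
  Ap_characteristic mu F p w = q%:E ->
  \int[mu]_t ((a * two_sided_sum r y z N t) `^ p * w t)%:E <=
  ((2 * a) `^ p * (sparse_cst p * (2 * q) `^ (Num.max 1 (p - 1)^-1 * p)))%:E *
  \int[mu]_t (`|X t| `^ p * w t)%:E.
Proof.
move=> a0 Apq.
have q0 : (0 < q)%R by have := Ap_gt0 mu hF p1 hw; rewrite Apq lte_fin.
have Q0 : (0 < 2 * q)%R by rewrite mulr_gt0.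
have /choice[wn] : forall n, exists wn : T -> R, exists sn : T -> R,
    [/\ (forall t, (0 < wn t)%R) /\ (forall t, (0 < sn t)%R),
    measurable_wrt (F n) wn /\ measurable_wrt (F n) sn,
    forall A, F n A -> \int[mu]_(t in A) (wn t)%:E = \int[mu]_(t in A) (w t)%:E,
    forall A, F n A -> \int[mu]_(t in A) (sn t)%:E =
      \int[mu]_(t in A) (w t `^ (- (p - 1)^-1)%R)%:E &
    forall t, (wn t * sn t `^ (p - 1) <= 2 * q)%R].
  move=> n; apply: (Ap_versions hF p1 hw n Q0).
  by rewrite Apq lte_fin ltr_pMl// ltr1n.
move=> /choice[sn ws].
have wn0 n t : (0 < wn n t)%R by have [[]] := ws n.
have sn0 n t : (0 < sn n t)%R by have [[]] := ws n.
have mwn n : measurable_wrt (F n) (wn n) by have [_ []] := ws n.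
have msn n : measurable_wrt (F n) (sn n) by have [_ []] := ws n.
have wnE n A : F n A -> \int[mu]_(t in A) (wn n t)%:E = \int[mu]_(t in A) (w t)%:E.
  by have [_ _ + _ _] := ws n; apply.
have snE n A : F n A -> \int[mu]_(t in A) (sn n t)%:E =
    \int[mu]_(t in A) (w t `^ (- (p - 1)^-1)%R)%:E.
  by have [_ _ _ + _] := ws n; apply.
have wsQ n t : (wn n t * sn n t `^ (p - 1) <= 2 * q)%R.
  by have [_ _ _ _ +] := ws n; apply.
have Bp := stage_sum_bound hF p1 mw w0 wn0 sn0 mwn msn wnE snE Q0 wsQ mXp Xp0 y0 my yE
  r2 (ltn0Sn N) N.
have Bm := stage_sum_bound hF p1 mw w0 wn0 sn0 mwn msn wnE snE Q0 wsQ mXm Xm0 z0 mz zE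
  r2 (ltn0Sn N) N.
set c := (sparse_cst p * _)%R in Bp Bm *.
have c0 : (0 <= c)%R by rewrite mulr_ge0 ?sparse_cst_ge0 ?powR_ge0.
have msy := measurable_stage_sum hF r N.+1 N my.
have msz := measurable_stage_sum hF r N.+1 N mz.
have ssy0 t : (0 <= stage_sum r N.+1 (y^~ t) N)%R by exact: stage_sum_ge0.
have ssz0 t : (0 <= stage_sum r N.+1 (z^~ t) N)%R by exact: stage_sum_ge0.
have absX : \int[mu]_t (`|X t| `^ p * w t)%:E =
    \int[mu]_t (Num.max (X t) 0 `^ p * w t)%:E +
    \int[mu]_t (Num.max (- X t) 0 `^ p * w t)%:E.
  rewrite -ge0_integralD_EFin; [|exact: measurableT|exact: mpow|exact: mpow
    |by move=> t _; exact: pow0|by move=> t _; exact: pow0].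
  apply: eq_integral => t _; rewrite -mulrDl; congr (_ * _)%:E.
  have [X0|X0] := leP 0%R (X t).
    rewrite (@max_idPr _ _ (- X t)%R 0%R _) ?oppr_le0//.
    by rewrite powR0 ?gt_eqF// addr0 ger0_norm.
  rewrite (@max_idPl _ _ (- X t)%R 0%R _) ?oppr_ge0 ?ltW//.
  by rewrite powR0 ?gt_eqF// add0r ltr0_norm.
apply: (@le_trans _ _ (\int[mu]_t ((2 * a) `^ p *
    (stage_sum r N.+1 (y^~ t) N `^ p * w t +
     stage_sum r N.+1 (z^~ t) N `^ p * w t))%:E)).
  apply: ge0_le_integral_EFin => //.
  - apply: (mpow (f := fun t => a * two_sided_sum r y z N t)%R).
    by apply: measurable_funM => //; exact: (measurable_two_sided hF).
  - by apply: measurable_funM => //; apply: measurable_funD; exact: mpow.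
  - move=> t _; rewrite -mulrDl mulrA ler_wpM2r ?(ltW (w0 t))//.
    rewrite powRM ?two_sided_ge0// [(2 * a)%R]mulrC powRM// -mulrA ler_wpM2l ?powR_ge0//.
    exact: powR_add_le (ltW p0) _ _.
rewrite ge0_integralZl_real; last 4 first.
- exact: measurableT.
- exact: powR_ge0.
- by apply: measurable_funD; exact: mpow.
- by move=> t _; rewrite addr_ge0 ?pow0.
rewrite EFinM -muleA; apply: lee_wpmul2l; first by rewrite lee_fin powR_ge0.
rewrite ge0_integralD_EFin; [|exact: measurableT|exact: mpow|exact: mpow
  |by move=> t _; exact: pow0|by move=> t _; exact: pow0].
rewrite absX ge0_muleDr; first exact: (leeD Bp Bm).
  by apply: integral_ge0 => t _; rewrite lee_fin.
by apply: integral_ge0 => t _; rewrite lee_fin.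
Qed.

(** This serves the convention 0 * oo = 0: with an infinite characteristic the theorem has content
    only if [X] vanishes almost everywhere, and then so do [y n] and [z n]. *)
Lemma two_sided_null (a : R) N :
  \int[mu]_t (`|X t| `^ p * w t)%:E = 0 ->
  \int[mu]_t ((a * two_sided_sum r y z N t) `^ p * w t)%:E = 0.
Proof.
move=> IX0.
have myT n := measurable_wrt_fun (sF n) (@Fm n) (@my n).
have mzT n := measurable_wrt_fun (sF n) (@Fm n) (@mz n).
have FT n : F n setT by rewrite -(measurable_subalgE (sF n)); exact: measurableT.
have mabs : measurable_fun [set: T] (fun t => `|X t|%R) by exact: measurableT_comp.
have X0 t : (`|X t| `^ p * w t = 0)%R -> X t = 0%R.
  move=> /eqP; rewrite mulf_eq0 (gt_eqF (w0 t)) orbF powR_eq0 (gt_eqF p0) /= andbT normr_eq0.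
  by move/eqP.
have Ip : \int[mu]_t (Num.max (X t) 0)%:E = 0.
  apply: (@ge0_integral_eq0_dominated _ _ _ _ _ _ _ _ _ _ _ IX0) => //; first exact: mpow.
  by move=> t /X0 ->; rewrite maxxx.
have Im : \int[mu]_t (Num.max (- X t) 0)%:E = 0.
  apply: (@ge0_integral_eq0_dominated _ _ _ _ _ _ _ _ _ _ _ IX0) => //; first exact: mpow.
  by move=> t /X0 ->; rewrite oppr0 maxxx.
pose f t := (\sum_(n < N.+1) (y n t + z n t))%R.
have f0 t : (0 <= f t)%R by apply: sumr_ge0 => n _; rewrite addr_ge0.
have If : \int[mu]_t (f t)%:E = 0.
  rewrite /f; under eq_integral do rewrite -sumEFin.
  rewrite ge0_integral_sum//; last 2 first.
  - by move=> n; apply/measurable_EFinP; exact: measurable_funD.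
  - by move=> n t _; rewrite lee_fin addr_ge0.
  rewrite big1// => n _; rewrite ge0_integralD_EFin//.
  by rewrite yE// zE// Ip Im adde0.
apply: (@ge0_integral_eq0_dominated _ _ _ _ _ _ _ _ _ _ _ If) => //.
- by apply: measurable_sum => n; exact: measurable_funD.
- apply: (mpow (f := fun t => a * two_sided_sum r y z N t)%R).
  by apply: measurable_funM => //; exact: (measurable_two_sided hF).
move=> t /eqP; rewrite /f psumr_eq0; last by move=> n _; rewrite addr_ge0.
move=> /allP all0.
have yz n : (n <= N)%N -> y n t = 0%R /\ z n t = 0%R.
  move=> nN; have nN' : (n < N.+1)%N by [].
  have /= := all0 (Ordinal nN') (mem_index_enum _).
  by rewrite paddr_eq0// => /andP[/eqP -> /eqP ->].
have ss0 (x : nat -> R) : (forall n, (n <= N)%N -> x n = 0%R) -> stage_sum r N.+1 x N = 0%R.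
  move=> x0; rewrite /stage_sum big1// => k _; rewrite x0 ?if_same//.
  by rewrite -ltnS.
rewrite /two_sided_sum !ss0 ?addr0 ?mulr0 ?powR0 ?mul0r ?gt_eqF//.
- by move=> n /yz[].
- by move=> n /yz[].
Qed.

End two_sided_bound.

Theorem theorem1p1 (R : realType) (p : R) (hp : (1 < p)%R) :
  exists C : R,
    forall (r : R) (hr : (2 < r)%R)
      (d : measure_display) (T : measurableType d) (mu : probability T R)
      (F : nat -> set (set T)) (hF : filtration F)
      (w : T -> R) (hw : is_weight F w)
      (X : T -> R) (mX : measurable_wrt (filtration_infty F) X)
      (iX : mu.-integrable [set: T] (EFin \o X))
      (M : nat -> T -> R) (hM : forall n, is_condexp mu (F n) X (M n)),
    weighted_Lnorm mu p w (variation_seq r M) <=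
      (C * Num.sqrt (r / (r - 2)))%:E
      * Ap_characteristic mu F p w `^ (Num.max 1 (p - 1)^-1)%R
      * weighted_Lnorm mu p w (EFin \o X).
Proof.
have p0 : (0 < p)%R by exact: lt_trans hp.
pose gam := Num.max 1%R (p - 1)^-1%R.
have gam0 : (0 < gam)%R by rewrite lt_max ltr01.
have sc0 : (0 < sparse_cst p + 1)%R by rewrite ltr_wpDl ?sparse_cst_ge0.
(* 128 is 2 * 64, the 64 from the pathwise bound and the 2 from adding two sums; 2^gam pays for
   using 2 q. The added 1 makes the constant positive, so that its product with an infinite
   characteristic is infinite. *)
exists (128 * (sparse_cst p + 1) `^ p^-1 * 2 `^ gam)%R.
move=> r hr d T mu F hF w hw X mX iX M hM.
have sF n : sigma_algebra [set: T] (F n) by case: hF.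
have Fm n : F n `<=` measurable by case: hF.
have w0 t : (0 < w t)%R by case: hw.
have mw : measurable_fun [set: T] w.
  by case: hw => mw _; exact: (measurable_filtration_infty hF).
have mXT : measurable_fun [set: T] X by exact: (measurable_filtration_infty hF).
have /choice[y yP] n := condexp_decomposition (sF n) (Fm n) mXT iX (hM n).
pose z n t := (y n t - M n t)%R.
have my n : measurable_wrt (F n) (y n) by case: (yP n).
have mz n : measurable_wrt (F n) (z n).
  by have [mM _ _] := hM n; exact: (measurable_funB (my n) mM).
have y0 n t : (0 <= y n t)%R by case: (yP n).
have z0 n t : (0 <= z n t)%R by rewrite subr_ge0; case: (yP n).
have yE n A : F n A ->
    \int[mu]_(t in A) (y n t)%:E = \int[mu]_(t in A) (Num.max (X t) 0)%:E.
  by case: (yP n) => _ _ _ + _; apply.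
have zE n A : F n A ->
    \int[mu]_(t in A) (z n t)%:E = \int[mu]_(t in A) (Num.max (- X t) 0)%:E.
  by case: (yP n) => _ _ _ _; apply.
have ME n t : M n t = (y n t - z n t)%R by rewrite /z opprB addrC subrK.
set a := (64 * Num.sqrt (r / (r - 2)))%R.
have a0 : (0 <= a)%R by rewrite mulr_ge0.
have VJ := integral_variation_le (mu := mu) hF p0 hr mw w0 y0 z0 my mz ME.
rewrite -/a in VJ.
rewrite /weighted_Lnorm; set J := \int[mu]_t (`|variation_seq r M t| `^ p * _) in VJ *.
have -> : \int[mu]_t (`|(EFin \o X) t| `^ p * (w t)%:E) =
    \int[mu]_t (`|X t| `^ p * w t)%:E by [].
set I := \int[mu]_t _.
have I0 : 0 <= I.
  by apply: integral_ge0 => t _; rewrite lee_fin mulr_ge0 ?powR_ge0 ?ltW.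
have J0 : 0 <= J.
  by apply: integral_ge0 => t _; rewrite mule_ge0 ?poweR_ge0// lee_fin ltW.
have ip0 : (0 <= p^-1)%R by rewrite invr_ge0 ltW.
have mono (u v : \bar R) : 0 <= u -> u <= v -> u `^ p^-1 <= v `^ p^-1.
  move=> u0 uv; apply: gt0_ler_poweR; rewrite ?in_itv/= ?leey ?u0//.
  by rewrite (le_trans u0 uv).
have sq0 : (0 < Num.sqrt (r / (r - 2)))%R.
  by rewrite sqrtr_gt0 divr_gt0 ?subr_gt0// (lt_trans _ hr).
have := Ap_gt0 mu hF hp hw.
case Apq : (Ap_characteristic mu F p w) => [q| |//] Ap0.
  have q0 : (0 <= q)%R by rewrite -lee_fin ltW.
  have {}VJ := VJ _ (fun N => two_sided_bound hF hp hr hw mXT y0 z0 my mz yE zE N a0 Apq).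
  apply: le_trans (mono _ _ J0 VJ) _; rewrite -/I poweRM ?lee_fin//; last first.
    by rewrite !mulr_ge0 ?powR_ge0 ?sparse_cst_ge0.
  rewrite lee_wpmul2r ?poweR_ge0// !poweR_EFin -EFinM lee_fin -/gam.
  rewrite (powRM _ (powR_ge0 (2 * a) p)) ?mulr_ge0 ?powR_ge0 ?sparse_cst_ge0//.
  rewrite (powRM _ (sparse_cst_ge0 p)) ?powR_ge0//.
  rewrite -!powRrM mulfV ?gt_eqF// powRr1 ?mulr_ge0// -(mulrA gam) mulfV ?gt_eqF// mulr1.
  rewrite powRM//.
  rewrite [leRHS](_ : _ = 2 * a * ((sparse_cst p + 1) `^ p^-1 * (2 `^ gam * q `^ gam)))%R; last first.
    by rewrite /a; ring.
  rewrite ler_wpM2l ?mulr_ge0// ler_wpM2r ?mulr_ge0 ?powR_ge0//.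
  by apply: ge0_le_powR; rewrite ?sparse_cst_ge0// lerDl.
(* The characteristic is +oo from here on: the right-hand side is +oo unless the norm of [X] is
   0. *)
rewrite poweRyr ?gt_eqF//.
have C0 : (0 < 128 * (sparse_cst p + 1) `^ p^-1 * 2 `^ gam * Num.sqrt (r / (r - 2)))%R.
  by rewrite !mulr_gt0 ?powR_gt0.
rewrite gt0_muley ?lte_fin//.
have [IX0|IX0] := eqVneq I 0; last first.
  by rewrite gt0_mulye ?leey// poweR_gt0// lt0e IX0.
have J00 : J = 0.
  apply/eqP; rewrite eq_le J0 andbT; apply: VJ => N.
  by rewrite (two_sided_null hF r hp hw mXT y0 z0 my mz yE zE).
by rewrite J00 poweR0r ?invr_neq0 ?gt_eqF// mule_ge0 ?poweR_ge0.
Qed.
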